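(* Let $X$ be the double exponential Ornstein–Uhlenbeck process with $\sigma=1$, and let $t>0$, $h>0$. Let $N$ be a Poisson random variable with parameter $\lambda h$, and let $\{S_k\}_{k=1,2,\dots}$ be i.i.d. random variables following the mixture of double exponential distributions with density (conditionally on $U$) $$f_{S_k}(y)=p\,\eta e^{\theta hU}e^{-\eta e^{\theta hU}y}I_{y\ge0}+q\,\varphi e^{\theta hU}e^{\varphi e^{\theta hU}y}I_{y<0},\qquad k=1,2,\dots,$$ where $U$ is uniformly distributed on $[0,1]$; i.e. the $S_k$ are i.i.d. with density $y\mapsto\int_0^1\big[p\eta e^{\theta hu}e^{-\eta e^{\theta hu}y}I_{y\ge0}+q\varphi e^{\theta hu}e^{\varphi e^{\theta hu}y}I_{y<0}\big]du$. Assume that $X_t$, $N$ and $\{S_k\}$ are independent. Then $$X_{t+h}\overset{d}{=}X_te^{-\theta h}+\sum_{k=1}^NS_k .$$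
   Context: Parameters: $\theta>0$, $\lambda>0$, $\eta>0$, $\varphi>0$, $p,q>0$ with $p+q=1$. Let $Y_1,Y_2,\dots$ be i.i.d. with density $f_Y(x)=p\eta e^{-\eta x}I_{[x\ge0]}+q\varphi e^{\varphi x}I_{[x<0]}$, $(N_t)_{t\ge0}$ a Poisson process with rate $\lambda$ independent of $(Y_i)$, and $Z_t=\sum_{i=1}^{N_t}Y_i$. The double exponential Ornstein–Uhlenbeck process is the solution of $X_t=x_0-\theta\int_0^tX_s\,ds+\sigma Z_t$, $t\ge0$, with $x_0\in\mathbb R$ and here $\sigma=1$. The symbol $\overset{d}{=}$ denotes equality in distribution, and an empty sum is $0$. *)

(* Defs.v *)
From HB Require Import structures.
From mathcomp Require Import all_boot all_order all_algebra finmap.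
From mathcomp Require Import all_classical all_reals all_analysis.

Set Implicit Arguments.
Unset Strict Implicit.
Unset Printing Implicit Defensive.

Import Order.TTheory GRing.Theory Num.Theory.
Import numFieldNormedType.Exports.

Local Open Scope classical_set_scope.
Local Open Scope ring_scope.

Section independence.
Context d (T : measurableType d) (R : realType) (P : probability T R).

Definition independent_systems (I : choiceType) (F : I -> set_system T) :=
  forall (J : {fset I}) (E : I -> set T), (forall i, i \in J -> F i (E i)) ->
    P (\bigcap_(i in [set` J]) E i) = (\prod_(i <- J) P (E i))%E.

Definition independent_RVs d' (T' : measurableType d') (I : choiceType)
    (X : I -> T -> T') :=
  independent_systems (fun i => g_sigma_algebra_preimage (X i)).

(* The sigma-algebra generated by the X i, i in D. *)
Definition sigma_of_family d' (T' : measurableType d') (I : Type) (D : set I)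
    (X : I -> T -> T') : set_system T :=
  <<s \bigcup_(i in D) g_sigma_algebra_preimage (X i) >>.

End independence.

Section laws.
Context d (T : measurableType d) (R : realType) (P : probability T R).

Definition has_density (X : {RV P >-> R}) (f : R -> R) :=
  forall A, measurable A ->
    distribution P X A = (\int[lebesgue_measure]_(x in A) (f x)%:E)%E.

(* poisson_pmf is a probability mass function only for a positive rate; all
   the rates used below are positive. *)
Definition has_poisson_law (r : R) (N : T -> nat) :=
  forall k, P (N @^-1` [set k]) = (poisson_pmf r k)%:E.

(* Restricted to measurable sets: the values of a measure elsewhere are
   irrelevant. *)
Definition eq_in_law (X X' : {RV P >-> R}) :=
  forall A, measurable A -> distribution P X A = distribution P X' A.

End laws.

(* Families indexed by 1, 2, ... in the mathematics are indexed from 0 here: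
   Y_k is Y k.-1, and the sum of Y_1, ..., Y_n is \sum_(k < n) Y k. *)
Section random_sum.
Context d (T : measurableType d) (R : realType) (P : probability T R).
Variables (N : {RV P >-> nat}) (Y : nat -> {RV P >-> R}).

Definition random_sum (w : T) : R := \sum_(k < N w) Y k w.

Lemma measurable_random_sum : measurable_fun setT random_sum.
Proof.
move=> _ A mA; rewrite setTI.
have -> : random_sum @^-1` A = \bigcup_n (N @^-1` [set n] `&`
    (fun w => \sum_(k < n) Y k w) @^-1` A).
  apply/seteqP; split=> [w Aw|w [n _ [/= Nw]]]; first by exists (N w).
  by rewrite /random_sum Nw.
apply: bigcup_measurable => n _; apply: measurableI.
  exact: measurable_funPTI.
rewrite -[X in measurable X]setTI.
by apply: measurable_sum => // k; exact: measurable_funPT.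
Qed.

HB.instance Definition _ :=
  isMeasurableFun.Build _ _ _ _ random_sum measurable_random_sum.

End random_sum.

Section double_exponential.
Context (R : realType).

Definition double_exp_pdf (p q eta phi x : R) : R :=
  if 0 <= x then p * eta * expR (- eta * x) else q * phi * expR (phi * x).

(* Double exponential with both rates multiplied by exp (c U), U uniform on
   [0, 1]. *)
Definition mixed_double_exp_pdf (p q eta phi c y : R) : R :=
  \int[lebesgue_measure]_(u in `[0, 1])
    double_exp_pdf p q (eta * expR (c * u)) (phi * expR (c * u)) y.

End double_exponential.

(* Processes indexed by [0, +oo[ are functions on R; their values at negative
   times are never constrained. *)
Section processes.
Context d (T : measurableType d) (R : realType) (P : probability T R).

(* The paths being almost surely nondecreasing, the truncated subtraction of
   nat gives the increments almost surely. *)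
Definition increment (N : R -> T -> nat) (s t : R) (w : T) : nat :=
  (N t w - N s w)%N.

Definition counting_path (n : R -> nat) :=
  [/\ n 0 = 0%N,
      forall s t, 0 <= s -> s <= t -> (n s <= n t)%N &
      forall t, 0 <= t -> n s @[s --> t^'+] --> n t].

Definition poisson_process (lambda : R) (N : R -> {RV P >-> nat}) :=
  [/\ {ae P, forall w, counting_path (fun t => N t w)},
      forall s t, 0 <= s -> s < t ->
        has_poisson_law P (lambda * (t - s)) (increment N s t) &
      forall t : nat -> R, 0 <= t 0%N ->
        {homo t : i j / (i <= j)%N >-> i <= j} ->
        independent_RVs P (fun i => increment N (t i) (t i.+1))].

(* X_t = x0 - theta \int_0^t X_s ds + sigma Z_t for all t >= 0, almost surely;
   integrability of the path is part of the meaning of the equation. *)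
Definition OU_solution (theta sigma x0 : R) (Z X : R -> {RV P >-> R}) :=
  {ae P, forall w, forall t, 0 <= t ->
     lebesgue_measure.-integrable `[0, t] (fun s => (X s w)%:E) /\
     X t w = x0 - theta * (\int[lebesgue_measure]_(s in `[0, t]) X s w)
             + sigma * Z t w}.

End processes.

(* Main.v *)
(* The decay [r s = exp (- theta s)] and the law of the marks determine, for an
   interval [D] of ages, the operator [K_D f x = \int_D E f (x + r s Y) ds].
   Solving the equation by Euler steps of size [t / n] writes [X_t] as the limit of
   [r t * x0] plus the damped increments of the driving compound Poisson process,
   whose laws are the exponentials of multiples of the commuting operators
   [f |-> E f (. + c Y)].  The exponential of a sum of commuting operators being the
   product of the exponentials, letting [n] go to infinity gives
     [E f (X_t) = exp (- lambda t) (exp (lambda K_[0, t[) f) (r t * x0)]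
   for continuous [f] with values in [0, 1].  The sum of the [N] variables [S_k] has
   law [exp (- lambda h) exp (lambda K_[0, h[)], because [h] times the law of [S_k] is
   [\int_[0, h[ (law of r s Y) ds].  As multiplication of the argument by [r h] shifts
   ages by [h], the theorem is the identity
     [exp (lambda K_[h, t + h[) exp (lambda K_[0, h[) = exp (lambda K_[0, t + h[)]. *)

Require Import Defs.
From HB Require Import structures.
From mathcomp Require Import all_boot all_order all_algebra finmap.
From mathcomp Require Import all_classical all_reals all_analysis.
From mathcomp Require Import measurable_realfun ring lra.

Set Implicit Arguments.
Unset Strict Implicit.
Unset Printing Implicit Defensive.

Import Order.TTheory GRing.Theory Num.Theory.
Import numFieldNormedType.Exports.

Local Open Scope classical_set_scope.
Local Open Scope ring_scope.

(** * Exponentials of commuting operators *)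

(** The Poisson process is given through its increments; the jump times and the explicit solution
    would have to be built from them, whereas Euler steps use only the increments over a grid. The
    error of the scheme is controlled path by path through the total size of the jumps, so it tends
    to 0 almost surely. Hence the test functions: continuity transports the limit, boundedness
    allows dominated convergence.

    A step multiplies by [exp (- theta e)] rather than by [1 - theta e]. The weights are then exact
    values of the decay at grid points, and the grid operators are already exponentials, built on a
    step function that approximates the decay.

    The operators act on nonnegative measurable functions with values in [0, +oo], where every
    exchange of sums and integrals is Tonelli's theorem or countable additivity.

    The formula for one fixed time is applied twice: at [t + h] to [f], and at [t] to the function
    obtained from [f] by integrating out the compound Poisson sum. *)

Section double_series.
Local Open Scope ereal_scope.
Context (R : realType).

Lemma nneseries_ord (u : nat -> \bar R) n : (forall k, 0 <= u k) ->
  \sum_(k <oo) (if (k < n)%N then u k else 0) = \sum_(k < n) u k.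
Proof.
move=> u0; rewrite (nneseries_split _ n) ?add0n; last by move=> k _; case: ifP.
rewrite [X in _ + X]eseries0 ?adde0; last first.
  by move=> k nk _; rewrite ltnNge nk.
by rewrite big_mkord; apply: eq_bigr => k _; rewrite ltn_ord.
Qed.

(** Extending the inner sums by zeros makes Tonelli applicable; for fixed [k] the terms with [n < k]
    vanish, and the others are indexed by [n = k + l]. *)
Lemma nneseries_antidiagonal (w : nat -> nat -> \bar R) :
  (forall k l, 0 <= w k l) ->
  \sum_(n <oo) \sum_(k < n.+1) w k (n - k)%N = \sum_(k <oo) \sum_(l <oo) w k l.
Proof.
move=> w0.
transitivity (\sum_(n <oo) \sum_(k <oo)
    (if (k < n.+1)%N then w k (n - k)%N else 0)).
  by apply: eq_eseriesr => n _; rewrite nneseries_ord.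
rewrite nneseries_interchange; last by move=> k l; case: ifP.
apply: eq_eseriesr => k _.
rewrite (nneseries_split _ k) ?add0n; last by move=> n _; case: ifP.
rewrite big_mkord big1 ?add0e; last first.
  by move=> i _; rewrite ltnS leqNgt ltn_ord.
rewrite -(nneseries_addn (f := fun n => if (k < n.+1)%N then w k (n - k)%N else 0));
  last by move=> n; case: ifP.
by apply: eq_eseriesr => n _; rewrite ltnS leq_addl addnK.
Qed.

End double_series.

Section exponential_of_operator.
Local Open Scope ereal_scope.
Context (R : realType).
Implicit Types (f : R -> \bar R) (A B C : (R -> \bar R) -> R -> \bar R).

Definition ge0_meas f := measurable_fun setT f /\ forall x, 0 <= f x.

(** Compatibility with series is what lets an operator pass inside the exponential series of another
    one. *)
Record sigma_linear A : Prop := SigmaLinear {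
  sigma_linear_meas : forall f, ge0_meas f -> ge0_meas (A f) ;
  sigma_linearD : forall f g, ge0_meas f -> ge0_meas g ->
    A (f \+ g) = A f \+ A g ;
  sigma_linearZ : forall (c : R) f, (0 <= c)%R -> ge0_meas f ->
    A (fun x => c%:E * f x) = fun x => c%:E * A f x ;
  sigma_linear_series : forall F : nat -> R -> \bar R,
    (forall n, ge0_meas (F n)) ->
    A (fun x => \sum_(n <oo) F n x) = fun x => \sum_(n <oo) A (F n) x }.

Definition expop (c : R) A f x :=
  \sum_(k <oo) (c ^+ k / k`!%:R)%:E * iter k A f x.

Lemma ge0_measD f g : ge0_meas f -> ge0_meas g -> ge0_meas (f \+ g).
Proof.
by move=> [mf f0] [mg g0]; split; [exact: emeasurable_funD|
  move=> x; rewrite adde_ge0].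
Qed.

Lemma ge0_measZ (c : R) f :
  (0 <= c)%R -> ge0_meas f -> ge0_meas (fun x => c%:E * f x).
Proof.
move=> c0 [mf f0]; split; first exact: measurable_funeM.
by move=> x; rewrite mule_ge0.
Qed.

Lemma ge0_meas_series (F : nat -> R -> \bar R) :
  (forall n, ge0_meas (F n)) -> ge0_meas (fun x => \sum_(n <oo) F n x).
Proof.
move=> hF; split; last by move=> x; apply: nneseries_ge0 => n _ _; apply hF.
apply: ge0_emeasurable_sum => n; last by move=> _; apply hF.
by move=> x _ _; apply hF.
Qed.

Lemma ge0_meas0 : ge0_meas (cst 0). Proof. by split. Qed.

Lemma ge0_meas_natmul f n : ge0_meas f -> ge0_meas (fun x => f x *+ n).
Proof.
move=> hf; under eq_fun do rewrite -mule_natl.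
exact: ge0_measZ.
Qed.

Lemma ge0_meas_sum I (s : seq I) (F : I -> R -> \bar R) :
  (forall i, ge0_meas (F i)) -> ge0_meas (fun x => \sum_(i <- s) F i x).
Proof.
move=> hF; elim: s => [|i s IHs].
  by under eq_fun do rewrite big_nil; exact: ge0_meas0.
by under eq_fun do rewrite big_cons; exact: ge0_measD.
Qed.

Lemma sigma_linear_natmul A f n : sigma_linear A -> ge0_meas f ->
  A (fun x => f x *+ n) = fun x => A f x *+ n.
Proof.
move=> lA hf; under eq_fun do rewrite -mule_natl.
by rewrite sigma_linearZ//; apply/funext => x; rewrite mule_natl.
Qed.

Lemma sigma_linear_sum A I (s : seq I) (F : I -> R -> \bar R) :
  sigma_linear A -> (forall i, ge0_meas (F i)) ->
  A (fun x => \sum_(i <- s) F i x) = fun x => \sum_(i <- s) A (F i) x.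
Proof.
move=> lA hF; elim: s => [|i s IHs].
  (* The empty sum: homogeneity with the scalar 0 gives that [A] maps 0 to 0. *)
  have := sigma_linearZ lA (lexx 0%R) ge0_meas0.
  under eq_fun do rewrite mul0e.
  under [X in _ = X -> _]eq_fun do rewrite mul0e.
  move=> A0; under eq_fun do rewrite big_nil.
  by rewrite A0; apply/funext => x; rewrite big_nil.
under eq_fun do rewrite big_cons.
rewrite (sigma_linearD lA (hF i) (ge0_meas_sum s hF)) IHs.
by apply/funext => x; rewrite big_cons.
Qed.

Lemma sigma_linear_iter A n : sigma_linear A -> sigma_linear (iter n A).
Proof.
move=> lA; elim: n => [|n [h1 h2 h3 h4]]; first by split.
split => /=.
- by move=> f hf; apply/(sigma_linear_meas lA)/h1.
- by move=> f g hf hg; rewrite h2// sigma_linearD//; exact: h1.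
- by move=> c f c0 hf; rewrite h3// sigma_linearZ//; exact: h1.
- by move=> F hF; rewrite h4// sigma_linear_series// => k; exact: h1.
Qed.

Lemma sigma_linear_comp A B : sigma_linear A -> sigma_linear B ->
  sigma_linear (A \o B).
Proof.
move=> lA [h1 h2 h3 h4]; split => /=.
- by move=> f hf; apply/(sigma_linear_meas lA)/h1.
- by move=> f g hf hg; rewrite h2// sigma_linearD//; exact: h1.
- by move=> c f c0 hf; rewrite h3// sigma_linearZ//; exact: h1.
- by move=> F hF; rewrite h4// sigma_linear_series// => k; exact: h1.
Qed.

Let coef_ge0 (c : R) k : (0 <= c -> 0 <= c ^+ k / k`!%:R)%R.
Proof. by move=> c0; rewrite divr_ge0 ?exprn_ge0. Qed.

Lemma expop_meas (c : R) A f : (0 <= c)%R -> sigma_linear A -> ge0_meas f ->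
  ge0_meas (expop c A f).
Proof.
move=> c0 lA hf; apply: ge0_meas_series => k; apply: ge0_measZ.
  exact: coef_ge0.
exact: (sigma_linear_meas (sigma_linear_iter k lA)).
Qed.

(** Induction step of the binomial formula: an extra factor [A] raises the first index of [a], an
    extra factor [B] the second. *)
Lemma pascal (V : nmodType) (a : nat -> nat -> V) n :
  ((\sum_(k < n.+1) a k.+1 (n - k)%N *+ 'C(n, k)) +
   \sum_(k < n.+1) a k (n.+1 - k)%N *+ 'C(n, k) =
   \sum_(k < n.+2) a k (n.+1 - k)%N *+ 'C(n.+1, k))%R.
Proof.
rewrite [RHS]big_ord_recl/= bin0 subn0.
under [in RHS]eq_bigr do rewrite /bump add1n binS subSS GRing.mulrnDr.
rewrite big_split/= [LHS]addrC addrA; congr (_ + _)%R.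
rewrite big_ord_recl/= bin0 subn0; congr (_ + _)%R.
rewrite [RHS]big_ord_recr/= bin_small// mulr0n addr0.
by apply: eq_bigr => i _; rewrite /bump add1n subSS.
Qed.

Variables (A B C : (R -> \bar R) -> R -> \bar R).
Hypotheses (lA : sigma_linear A) (lB : sigma_linear B).
Hypothesis AB : forall f, ge0_meas f -> A (B f) = B (A f).
Hypothesis CAB : forall f, ge0_meas f -> C f = A f \+ B f.

Let mA k f : ge0_meas f -> ge0_meas (iter k A f).
Proof. exact: (sigma_linear_meas (sigma_linear_iter k lA)). Qed.

Let mB k f : ge0_meas f -> ge0_meas (iter k B f).
Proof. exact: (sigma_linear_meas (sigma_linear_iter k lB)). Qed.

Let B_iterA k f : ge0_meas f -> B (iter k A f) = iter k A (B f).
Proof. by move=> hf; elim: k => //= k IHk; rewrite -AB ?IHk//; exact: mA. Qed.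

Lemma iter_commuting_sum f n : ge0_meas f ->
  iter n C f = fun x => \sum_(k < n.+1) iter k A (iter (n - k) B f) x *+ 'C(n, k).
Proof.
move=> hf; elim: n => [|n IHn].
  by apply/funext => x; rewrite big_ord_recl big_ord0 addr0.
have hab k l : ge0_meas (iter k A (iter l B f)) by exact/mA/mB.
have hsum : forall i : 'I_n.+1,
    ge0_meas (fun x => iter i A (iter (n - i) B f) x *+ 'C(n, i)).
  by move=> i; exact: ge0_meas_natmul.
rewrite iterS IHn CAB; last exact: (ge0_meas_sum _ hsum).
rewrite (sigma_linear_sum _ lA hsum) (sigma_linear_sum _ lB hsum).
apply/funext => x /=.
rewrite -(pascal (fun k l => iter k A (iter l B f) x)); congr (_ + _).
  by apply: eq_bigr => i _; rewrite sigma_linear_natmul.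
apply: eq_bigr => i _; rewrite sigma_linear_natmul// B_iterA; last exact: mB.
by rewrite subSn ?leq_ord.
Qed.

(** The right side is a double series in the powers [k] of [A] and [l] of [B]. Summed along
    [k + l = n] it becomes the binomial expansion of the n-th power of [C], since ['C(n, k) / n!] is
    [1 / (k! (n - k)!)]. *)
Lemma expop_commuting_sum (c : R) f : (0 <= c)%R -> ge0_meas f ->
  expop c C f = expop c A (expop c B f).
Proof.
move=> c0 hf; apply/funext => x; rewrite /expop.
pose w k l := (c ^+ k / k`!%:R)%:E *
  ((c ^+ l / l`!%:R)%:E * iter k A (iter l B f) x).
have w0 k l : 0 <= w k l.
  by rewrite !mule_ge0 ?lee_fin ?coef_ge0//; apply mA; exact: mB.
transitivity (\sum_(k <oo) \sum_(l <oo) w k l); last first.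
  apply: eq_eseriesr => k _.
  rewrite (sigma_linear_series (sigma_linear_iter k lA)); last first.
    by move=> l; apply: ge0_measZ; [exact: coef_ge0|exact: mB].
  rewrite -nneseriesZl; last first.
    move=> l _; rewrite (sigma_linearZ (sigma_linear_iter k lA)) ?coef_ge0//;
      last exact: mB.
    by rewrite mule_ge0 ?lee_fin ?coef_ge0//; apply mA; exact: mB.
  apply: eq_eseriesr => l _.
  by rewrite (sigma_linearZ (sigma_linear_iter k lA)) ?coef_ge0//; exact: mB.
rewrite -nneseries_antidiagonal//; apply: eq_eseriesr => n _.
rewrite iter_commuting_sum// ge0_sume_distrr; last first.
  by move=> k _; apply: (ge0_meas_natmul _ _).2; exact/mA/mB.
apply: eq_bigr => k _; rewrite /w -mule_natl !muleA -!EFinM.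
congr (_%:E * _).
have kn : (k <= n)%N by rewrite -ltnS.
rewrite -(bin_fact kn) !natrM -{1}(subnK kn) exprD.
field.
by rewrite !pnatr_eq0 -!lt0n !fact_gt0 bin_gt0.
Qed.

End exponential_of_operator.

(** * Shift operators *)

Section shift_operator.
Local Open Scope ereal_scope.
Context (R : realType) d (Z : measurableType d).
Variable m : {sigma_finite_measure set Z -> \bar R}.
Implicit Types (f : R -> \bar R) (D : set Z) (g : Z -> R).

(** Translation of the argument averaged over the image under [g] of [m] restricted to [D]. A
    general measure covers both the law of one mark and the product of time with marks. *)
Definition shiftop D g f (x : R) := \int[m]_(z in D) f (x + g z)%R.

Let joint g f (p : R * Z) := f (p.1 + g p.2)%R.

Lemma measurable_joint_shift D g f : measurable D -> measurable_fun [set: Z] g ->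
  ge0_meas f -> measurable_fun setT (joint g f \_ ([set: R] `*` D)).
Proof.
move=> mD mg [mf f0]; apply/(measurable_restrictT _ _).1.
  exact: measurableX.
apply: measurable_funTS; apply: measurableT_comp => //.
apply: measurable_funD => //; exact: measurableT_comp.
Qed.

(** As the integral of a section of a function on the product, the value is measurable in [x] by
    Tonelli's theorem. *)
Lemma shiftopE D g f x :
  shiftop D g f x = \int[m]_z (joint g f \_ ([set: R] `*` D)) (x, z).
Proof.
rewrite /shiftop integral_mkcond; apply: eq_integral => z _.
by rewrite !patchE !in_setX in_setT.
Qed.

Lemma measurable_shift D g f x : measurable_fun [set: Z] g -> ge0_meas f ->
  measurable_fun D (fun z => f (x + g z)%R).
Proof.
move=> mg [mf _]; apply: measurable_funTS; apply: measurableT_comp => //.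
exact: measurable_funD.
Qed.

Lemma shiftop_meas D g f : measurable D -> measurable_fun [set: Z] g ->
  ge0_meas f -> ge0_meas (shiftop D g f).
Proof.
move=> mD mg hf; split; last first.
  by move=> x; apply: integral_ge0 => z _; apply hf.
rewrite (funext (shiftopE D g f)).
apply: (measurable_fun_fubini_tonelli_F (joint g f \_ ([set: R] `*` D))).
  exact: measurable_joint_shift.
by move=> p; apply: erestrict_ge0 => q _; apply hf.
Qed.

Lemma shiftop_sigma_linear D g : measurable D -> measurable_fun [set: Z] g ->
  sigma_linear (shiftop D g).
Proof.
move=> mD mg; split.
- by move=> f; exact: shiftop_meas.
- move=> f1 f2 h1 h2; apply/funext => x.
  rewrite /shiftop ge0_integralD//; try exact: measurable_shift.
  + by move=> z _; apply h1.
  + by move=> z _; apply h2.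
- move=> c f c0 hf; apply/funext => x; rewrite /shiftop ge0_integralZl//.
  + exact: measurable_shift.
  + by move=> z _; apply hf.
- move=> F hF; apply/funext => x; rewrite /shiftop integral_nneseries//.
  + by move=> n; exact: measurable_shift.
  + by move=> n z _; apply hF.
Qed.

Lemma shiftop_setU D D' g f : measurable D -> measurable D' ->
  [disjoint D & D'] -> measurable_fun [set: Z] g -> ge0_meas f ->
  shiftop (D `|` D') g f = shiftop D g f \+ shiftop D' g f.
Proof.
move=> mD mD' DD' mg hf; apply/funext => x; rewrite /shiftop ge0_integral_setU//.
  exact: measurable_shift.
by move=> z _; apply hf.
Qed.

Lemma shiftop_le D g f (M : R) x : measurable D -> measurable_fun [set: Z] g ->
  ge0_meas f -> (forall y, f y <= M%:E) -> shiftop D g f x <= M%:E * m D.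
Proof.
move=> mD mg hf fM.
rewrite -integral_cst// /shiftop; apply: ge0_le_integral => //.
- by move=> z _; apply hf.
- exact: measurable_shift.
Qed.

End shift_operator.

Lemma fubini_tonelli_in (R : realType) d1 d2 (Z1 : measurableType d1)
    (Z2 : measurableType d2) (m1 : {sigma_finite_measure set Z1 -> \bar R})
    (m2 : {sigma_finite_measure set Z2 -> \bar R}) D1 D2
    (F : Z1 * Z2 -> \bar R) :
  measurable D1 -> measurable D2 -> measurable_fun setT F ->
  (forall z, (0 <= F z)%E) ->
  (\int[m1]_(x in D1) \int[m2]_(y in D2) F (x, y) =
   \int[m2]_(y in D2) \int[m1]_(x in D1) F (x, y))%E.
Proof.
move=> mD1 mD2 mF F0.
pose H := F \_ (D1 `*` D2).
have mH : measurable_fun setT H.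
  apply/(measurable_restrictT _ _).1; first exact: measurableX.
  exact: measurable_funTS.
have H0 z : (0 <= H z)%E by exact: erestrict_ge0.
have := fubini_tonelli (m1 := m1) (m2 := m2) H mH H0.
congr (_ = _); rewrite [RHS]integral_mkcond.
  apply: eq_integral => z1 _; rewrite patchE; case: ifPn => hz1.
    rewrite [RHS]integral_mkcond; apply: eq_integral => z2 _.
    by rewrite /H !patchE in_setX/= hz1.
  rewrite integral0_eq// => z2 _.
  by rewrite /H patchE in_setX/= (negbTE hz1).
apply: eq_integral => z2 _; rewrite patchE; case: ifPn => hz2.
  rewrite [RHS]integral_mkcond; apply: eq_integral => z1 _.
  by rewrite /H !patchE in_setX/= hz2 andbT.
rewrite integral0_eq// => z1 _.
by rewrite /H patchE in_setX/= (negbTE hz2) andbF.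
Qed.

(** Tonelli, together with the commutativity of addition of the two shifts. *)
Lemma shiftop_comm (R : realType) d1 d2 (Z1 : measurableType d1)
    (Z2 : measurableType d2) (m1 : {sigma_finite_measure set Z1 -> \bar R})
    (m2 : {sigma_finite_measure set Z2 -> \bar R}) D1 D2 g1 g2 f :
  measurable D1 -> measurable D2 -> measurable_fun setT g1 ->
  measurable_fun setT g2 -> ge0_meas f ->
  shiftop m1 D1 g1 (shiftop m2 D2 g2 f) = shiftop m2 D2 g2 (shiftop m1 D1 g1 f).
Proof.
move=> mD1 mD2 mg1 mg2 [mf f0]; apply/funext => x.
transitivity (\int[m1]_(z1 in D1) \int[m2]_(z2 in D2)
  f (x + g1 (z1, z2).1 + g2 (z1, z2).2)%R)%E; first by [].
rewrite (fubini_tonelli_in _ _ (F := fun z => f (x + g1 z.1 + g2 z.2)%R))//.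
  by do 2 (apply: eq_integral => ? _); rewrite addrAC.
apply: measurableT_comp => //; apply: measurable_funD; last exact: measurableT_comp.
by apply: measurable_funD => //; exact: measurableT_comp.
Qed.

Section equality_of_shift_operators.
Local Open Scope ereal_scope.
Context (R : realType).

Lemma ge0_integral_mrestr d (T : measurableType d) (m : {measure set T -> \bar R})
    (D : set T) (mD : measurable D) (f : T -> \bar R) :
  measurable_fun setT f -> (forall x, 0 <= f x) ->
  \int[mrestr m mD]_x f x = \int[m]_(x in D) f x.
Proof.
move=> mf f0.
rewrite [RHS](eq_measure_integral (mrestr m mD)); last first.
  by move=> A mA AD; rewrite /= /mrestr setIidl.
rewrite [LHS](ge0_negligible_integral (N := ~` D))//=.
- by rewrite setTD setCK.
- exact: measurableC.
- by rewrite /mrestr setICl measure0.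
Qed.

(** Both operators integrate [f (x + _)] against the image measures of the shifts, which are assumed
    equal. *)
Lemma eq_shiftop d1 d2 (Z1 : measurableType d1) (Z2 : measurableType d2)
    (m1 : {sigma_finite_measure set Z1 -> \bar R})
    (m2 : {sigma_finite_measure set Z2 -> \bar R}) D1 D2 g1 g2 f :
  measurable D1 -> measurable D2 -> measurable_fun setT g1 ->
  measurable_fun setT g2 -> ge0_meas f ->
  (forall A, measurable A -> m1 (g1 @^-1` A `&` D1) = m2 (g2 @^-1` A `&` D2)) ->
  shiftop m1 D1 g1 f = shiftop m2 D2 g2 f.
Proof.
move=> mD1 mD2 mg1 mg2 [mf f0] m12; apply/funext => x.
have mfx : measurable_fun setT (fun y => f (x + y)%R).
  by apply: measurableT_comp => //; exact: measurable_funD.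
rewrite /shiftop -(ge0_integral_mrestr _ mD1)//; last exact: measurableT_comp mfx mg1.
rewrite -[RHS](ge0_integral_mrestr _ mD2)//; last exact: measurableT_comp mfx mg2.
transitivity (\int[pushforward (mrestr m1 mD1) g1]_y f (x + y)%R).
  by rewrite ge0_integral_pushforward// preimage_setT.
transitivity (\int[pushforward (mrestr m2 mD2) g2]_y f (x + y)%R).
  by apply: eq_measure_integral => A mA _; exact: m12.
by rewrite ge0_integral_pushforward// preimage_setT.
Qed.

End equality_of_shift_operators.

(** * Continuity of shift operators and their exponentials in the shift and the argument *)

Section limits.
Local Open Scope ereal_scope.
Context (R : realType).

(* "Continuous convergence" of f_ n to f; with f_ constant it says that f is
   sequentially continuous. *)
Definition ccvg (f_ : nat -> R -> \bar R) (f : R -> \bar R) :=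
  forall (x_ : nat -> R) (x : R), x_ @ \oo --> x -> f_ n (x_ n) @[n --> \oo] --> f x.

(** Dominated convergence. Shift, function and argument vary together because iterating the operator
    moves all three at once. *)
Lemma shiftop_ccvg d (Z : measurableType d)
    (m : {sigma_finite_measure set Z -> \bar R}) (D : set Z)
    (g_ : nat -> Z -> R) (g : Z -> R) (f_ : nat -> R -> \bar R) f (M : R) :
  measurable D -> m D < +oo ->
  (forall n, measurable_fun setT (g_ n)) -> measurable_fun setT g ->
  (forall n, ge0_meas (f_ n)) -> ge0_meas f -> (forall n x, f_ n x <= M%:E) ->
  (forall z, D z -> g_ ^~ z @ \oo --> g z) -> ccvg f_ f ->
  ccvg (fun n => shiftop m D (g_ n) (f_ n)) (shiftop m D g f).
Proof.
move=> mD mDoo mg_ mg hf_ hf fM gcvg fcvg x_ x xcvg.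
apply: (@dominated_cvg _ _ _ m _ mD _ _ (cst M%:E)) => //.
- by move=> n; exact: measurable_shift.
- by move=> z Dz; apply: fcvg; apply: cvgD => //; exact: gcvg.
- apply/integrableP; split => //=.
  by rewrite integral_cst// lte_mul_pinfty// ?abse_ge0// abse_fin_num.
- by move=> n z Dz; rewrite gee0_abs//; apply hf_.
Qed.

End limits.

Section exponential_limit.
Local Open Scope ereal_scope.
Context (R : realType).

Lemma nneseries_dominated (u_ : nat -> nat -> \bar R) (u : nat -> \bar R)
    (g : nat -> R) :
  (forall n k, 0 <= u_ n k) -> (forall k, 0 <= u k) ->
  (forall n k, u_ n k <= (g k)%:E) -> \sum_(k <oo) (g k)%:E < +oo ->
  (forall k, u_ n k @[n --> \oo] --> u k) ->
  \sum_(k <oo) u_ n k @[n --> \oo] --> \sum_(k <oo) u k.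
Proof.
move=> u_0 u0 ug goo ucvg.
have g0 k : 0 <= (g k)%:E := le_trans (u_0 0%N k) (ug 0%N k).
rewrite -ge0_integral_count//.
under eq_fun do rewrite -ge0_integral_count//.
apply: (@dominated_cvg _ _ _ counting _ measurableT _ _ (EFin \o g)) => //.
- apply/integrableP; split => //.
  rewrite (eq_integral (EFin \o g)); last first.
    by move=> k _; rewrite gee0_abs//; exact: g0.
  by rewrite ge0_integral_count//; exact: g0.
- by move=> n k _; rewrite gee0_abs//; exact: ug.
Qed.

(** For [x > 0] this is the total mass 1 of the Poisson law, multiplied by [expR x]; the rate 0 is
    treated apart. *)
Lemma nneseries_exp (x : R) : (0 <= x)%R ->
  \sum_(k <oo) (x ^+ k / k`!%:R)%:E = (expR x)%:E.
Proof.
move=> x0; have [->|xn0] := eqVneq x 0%R.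
  rewrite (nneseries_split _ 1); last by move=> k _; rewrite lee_fin divr_ge0// exprn_ge0.
  rewrite big_nat1 expr0 fact0 divr1 expR0 eseries0 ?adde0//.
  by move=> [|k] //= _ _; rewrite expr0n mul0r.
have xp : (0 < x)%R by rewrite lt_neqAle eq_sym xn0.
have : \esum_(k in [set: nat]) (poisson_pmf x k)%:E = 1.
  by have := @probability_setT _ _ _ (poisson_prob x 0); rewrite /= /poisson_prob xp.
rewrite -nneseries_esumT; last first.
  by move=> k; rewrite lee_fin poisson_pmf_ge0.
under eq_eseriesr do rewrite /poisson_pmf xp EFinM muleC.
rewrite nneseriesZl; last by move=> k _; rewrite lee_fin divr_ge0// exprn_ge0.
move=> /(congr1 (fun z => (expR x)%:E * z)).
by rewrite muleA -EFinM -expRD subrr expR0 mul1e mule1.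
Qed.

Lemma iter_shiftop_le d (Z : measurableType d)
    (m : {sigma_finite_measure set Z -> \bar R}) (D : set Z) (g : Z -> R)
    f (M : R) k x :
  measurable D -> m D = M%:E -> measurable_fun setT g -> ge0_meas f ->
  (forall y, f y <= 1) -> iter k (shiftop m D g) f x <= (M ^+ k)%:E.
Proof.
move=> mD mDM mg hf f1; elim: k x => [//|k IHk] x.
rewrite iterS exprS mulrC EFinM -mDM; apply: shiftop_le => //.
by apply/(sigma_linear_meas (sigma_linear_iter k _))/hf; exact: shiftop_sigma_linear.
Qed.

(** Each iterate converges by [shiftop_ccvg]. An operator of mass [M] multiplies bounds by [M], so
    the exponential series of [c * M] dominates. *)
Lemma expop_shiftop_ccvg d (Z : measurableType d)
    (m : {sigma_finite_measure set Z -> \bar R}) (D : set Z)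
    (g_ : nat -> Z -> R) (g : Z -> R) f (c M : R) :
  (0 <= c)%R -> measurable D -> m D = M%:E ->
  (forall n, measurable_fun setT (g_ n)) -> measurable_fun setT g ->
  ge0_meas f -> (forall x, f x <= 1) -> ccvg (fun=> f) f ->
  (forall z, D z -> g_ ^~ z @ \oo --> g z) ->
  ccvg (fun n => expop c (shiftop m D (g_ n)) f) (expop c (shiftop m D g) f).
Proof.
move=> c0 mD mDM mg_ mg hf f1 fcvg gcvg x_ x xcvg.
have M0 : (0 <= M)%R by rewrite -lee_fin -mDM.
have hiter k h : measurable_fun setT h -> ge0_meas (iter k (shiftop m D h) f).
  move=> mh; apply/(sigma_linear_meas (sigma_linear_iter k _))/hf.
  exact: shiftop_sigma_linear.
have coef0 (a : R) k : (0 <= a -> 0 <= a ^+ k / k`!%:R)%R.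
  by move=> a0; rewrite divr_ge0// exprn_ge0.
rewrite /expop; apply: (@nneseries_dominated _ _
  (fun k => (c * M) ^+ k / k`!%:R)%R).
- by move=> n k; rewrite mule_ge0 ?lee_fin ?coef0//; exact: (hiter _ _ _).2.
- by move=> k; rewrite mule_ge0 ?lee_fin ?coef0//; exact: (hiter _ _ _).2.
- move=> n k; rewrite exprMn mulrAC.
  rewrite [leRHS]EFinM lee_wpmul2l ?lee_fin ?coef0//.
  exact: iter_shiftop_le.
- by rewrite nneseries_exp ?mulr_ge0// ltry.
- move=> k; apply: cvgeZl => //.
  elim: k x_ x xcvg => [|k IHk] x_ x xcvg; first exact: fcvg.
  rewrite /=; apply: (shiftop_ccvg (M := M ^+ k) mD _ mg_ mg) => //.
  + by rewrite mDM ltry.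
  + by move=> n; exact: hiter.
  + exact: hiter.
  + by move=> n y; exact: iter_shiftop_le.
Qed.

End exponential_limit.

(** * Integrals of sums of independent variables *)

Section independence_integrals.
Local Open Scope ereal_scope.
Context (R : realType) d (T : measurableType d) (P : probability T R).

(* The law of (U, V) under P restricted to D is the product of the two laws
   scaled by P D, which turns the integral into an iterated one. *)
Let integral_indep_sum_RV (U V : {RV P >-> R}) (D : set T) f :
  measurable D -> ge0_meas f ->
  (forall B C, measurable B -> measurable C ->
    P (U @^-1` B `&` V @^-1` C `&` D) = P (U @^-1` B) * P (V @^-1` C) * P D) ->
  \int[P]_(w in D) f (U w + V w)%R = P D * \int[P]_w shiftop P setT V f (U w).
Proof.
move=> mD hf indep; have [mf f0] := hf.
pose UV w := (U w, V w).
have mUV : measurable_fun setT UV by apply/measurable_fun_pairP; split.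
pose F (z : R * R) := f (z.1 + z.2)%R.
have mF : measurable_fun setT F.
  by apply: measurableT_comp => //; exact: measurable_funD.
have F0 z : 0 <= F z by exact: f0.
have mFUV A : measurable_fun A (F \o UV).
  by apply: measurable_funTS; exact: measurableT_comp.
transitivity (\int[mrestr P mD]_w (F \o UV) w).
  by rewrite ge0_integral_mrestr// => w; exact: F0.
rewrite -[in LHS](@preimage_setT _ _ UV) -ge0_integral_pushforward//.
have PD0 : (0 <= fine (P D))%R by exact/fine_ge0.
pose m1 := mscale (NngNum PD0) (distribution P U).
rewrite (eq_measure_integral (m1 \x distribution P V)); last first.
  move=> A mA _; apply/esym/product_measure_unique => // B C mB mC.
  transitivity (P (U @^-1` B `&` V @^-1` C `&` D)); first by [].
  rewrite indep// /m1 /=; rewrite /mscale /= fineK ?fin_num_measure//.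
  by rewrite muleC muleA.
rewrite fubini_tonelli1//.
rewrite ge0_integral_mscale//=; last 2 first.
  - exact: measurable_fun_fubini_tonelli_F.
  - by move=> x _; exact: integral_ge0.
rewrite fineK ?fin_num_measure//; congr (_ * _).
rewrite ge0_integral_distribution//=; last 2 first.
  - exact: measurable_fun_fubini_tonelli_F.
  - by move=> x; exact: integral_ge0.
apply: eq_integral => w _; rewrite /fubini_F ge0_integral_distribution//.
by apply: measurableT_comp => //; exact: measurable_funD.
Qed.

(** Bare functions are allowed because [U] and [V] will be partial sums and scaled marks. [D] will
    be an event on later marks or on counting variables. *)
Lemma integral_indep_sum (U V : T -> R) (D : set T) f :
  measurable_fun setT U -> measurable_fun setT V -> measurable D -> ge0_meas f ->
  (forall B C, measurable B -> measurable C ->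
    P (U @^-1` B `&` V @^-1` C `&` D) = P (U @^-1` B) * P (V @^-1` C) * P D) ->
  \int[P]_(w in D) f (U w + V w)%R = P D * \int[P]_w shiftop P setT V f (U w).
Proof.
move=> mU mV.
pose U' : {RV P >-> R} := HB.pack U (isMeasurableFun.Build _ _ _ _ U mU).
pose V' : {RV P >-> R} := HB.pack V (isMeasurableFun.Build _ _ _ _ V mV).
exact: (@integral_indep_sum_RV U' V').
Qed.

Definition scaled_op (V : {RV P >-> R}) (c : R) :=
  shiftop P setT (fun w => c * V w)%R.

Lemma scaled_op_sigma_linear V c : sigma_linear (scaled_op V c).
Proof. by apply: shiftop_sigma_linear => //; exact: measurable_funM. Qed.

End independence_integrals.

(** * Weighted sums of independent marks *)

Section weighted_sums.
Local Open Scope ereal_scope.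
Context (R : realType) d (T : measurableType d) (P : probability T R).
Variable Y : nat -> {RV P >-> R}.

(** The weights form a list, so that their number may later depend on the outcome. *)
Definition wsum (x : R) (a : seq R) (w : T) : R :=
  (x + \sum_(k < size a) a`_k * Y k w)%R.

Lemma wsum_rcons x a c w :
  (wsum x (rcons a c) w = wsum x a w + c * Y (size a) w)%R.
Proof.
rewrite /wsum size_rcons big_ord_recr/= nth_rcons ltnn eqxx addrA.
congr (_ + _ + _)%R; apply: eq_bigr => k _.
by rewrite nth_rcons ltn_ord.
Qed.

Lemma measurable_wsum x a : measurable_fun setT (wsum x a).
Proof.
apply: measurable_funD => //; apply: measurable_sum => k.
exact: measurable_funM.
Qed.

Let measurable_scaled c k : measurable_fun setT (fun w => c * Y k w)%R.
Proof. exact: measurable_funM. Qed.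

Lemma g_sigma_algebra_preimage_measurable k A :
  g_sigma_algebra_preimage (Y k) A -> measurable A.
Proof. by move=> [B mB <-]; exact: measurable_funPT. Qed.

Hypothesis Y_indep : independent_RVs P Y.

Let bigcap_measurable (J : {fset nat}) E :
  (forall j, j \in J -> g_sigma_algebra_preimage (Y j) (E j)) ->
  measurable (\bigcap_(i in [set` J]) E i).
Proof.
move=> hE; apply: fin_bigcap_measurable; first exact: finite_fset.
by move=> j jJ; apply: g_sigma_algebra_preimage_measurable; exact: hE.
Qed.

(** The event on the next mark joins the family [E] at the free index [size a], and the assumption
    on [a] applies to the enlarged family. That assumption is a premise because the lemma serves
    both inside the induction of [indep_wsum] and after it. *)
Let indep_wsum_next x a c (J : {fset nat}) E :
  (forall (J : {fset nat}) E,
    (forall j, j \in J -> (size a <= j)%N) ->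
    (forall j, j \in J -> g_sigma_algebra_preimage (Y j) (E j)) ->
    forall B, measurable B ->
    P (wsum x a @^-1` B `&` \bigcap_(i in [set` J]) E i) =
      P (wsum x a @^-1` B) * P (\bigcap_(i in [set` J]) E i)) ->
  (forall j, j \in J -> (size a < j)%N) ->
  (forall j, j \in J -> g_sigma_algebra_preimage (Y j) (E j)) ->
  forall B C, measurable B -> measurable C ->
  P (wsum x a @^-1` B `&` (fun w => c * Y (size a) w)%R @^-1` C `&`
     \bigcap_(i in [set` J]) E i) =
  P (wsum x a @^-1` B) * P ((fun w => c * Y (size a) w)%R @^-1` C) *
  P (\bigcap_(i in [set` J]) E i).
Proof.
move=> IH hJ hE B C mB mC; set VC := _ @^-1` C.
pose E' j := if j == size a then VC else E j.
have aJ : size a \notin J by apply/negP => /hJ; rewrite ltnn.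
have E'J j : j \in J -> E' j = E j.
  by rewrite /E'; case: eqP => // -> /hJ; rewrite ltnn.
have hE' j : j \in (size a |` J)%fset -> g_sigma_algebra_preimage (Y j) (E' j).
  rewrite in_fset1U => /predU1P[->|jJ]; last by rewrite E'J//; exact: hE.
  rewrite /E' eqxx; exists ((fun y => c * y)%R @^-1` C); last by rewrite setTI.
  rewrite -[X in measurable X]setTI.
  by apply: (_ : measurable_fun setT (fun y => c * y)%R) => //; exact: measurable_funM.
have capE : \bigcap_(i in [set` (size a |` J)%fset]) E' i =
    VC `&` \bigcap_(i in [set` J]) E i.
  rewrite set_fsetU1 bigcap_setU1 /E' eqxx; congr (_ `&` _).
  by apply: eq_bigcapr => j /=; exact: E'J.
rewrite -setIA -capE IH//; last first.
  by move=> j; rewrite in_fset1U => /predU1P[->//|/hJ/ltnW].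
rewrite -muleA; congr (_ * _).
rewrite (Y_indep hE') big_fsetU1//= /E' eqxx; congr (_ * _).
rewrite (Y_indep hE) big_seq [RHS]big_seq.
by apply: eq_bigr => j jJ; rewrite -/(E' j) E'J.
Qed.

Lemma indep_wsum x a (J : {fset nat}) E :
  (forall j, j \in J -> (size a <= j)%N) ->
  (forall j, j \in J -> g_sigma_algebra_preimage (Y j) (E j)) ->
  forall B, measurable B ->
  P (wsum x a @^-1` B `&` \bigcap_(i in [set` J]) E i) =
    P (wsum x a @^-1` B) * P (\bigcap_(i in [set` J]) E i).
Proof.
elim/last_ind: a J E => [|a c IHa] J E hJ hE B mB.
  have -> : wsum x [::] = cst x.
    by apply/funext => w; rewrite /wsum big_ord0 addr0.
  rewrite preimage_cst; case: ifPn => _; first by rewrite setTI probability_setT mul1e.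
  by rewrite set0I measure0 mul0e.
rewrite size_rcons in hJ.
pose f y : \bar R := (\1_B y)%:E.
have hf : ge0_meas f by split=> [|y]; [exact/measurable_EFinP|rewrite lee_fin].
(* The integral on the right does not depend on [J']: the set [J] gives the joint probability, the
   empty set the probability of the event on the sum alone. *)
have key (J' : {fset nat}) E' : (forall j, j \in J' -> (size a < j)%N) ->
    (forall j, j \in J' -> g_sigma_algebra_preimage (Y j) (E' j)) ->
    P (wsum x (rcons a c) @^-1` B `&` \bigcap_(i in [set` J']) E' i) =
    P (\bigcap_(i in [set` J']) E' i) *
    \int[P]_w shiftop P setT (fun w => c * Y (size a) w)%R f (wsum x a w).
  move=> hJ' hE'; rewrite -integral_indep_sum//; last 3 first.
  - exact: measurable_wsum.
  - exact: bigcap_measurable.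
  - exact: indep_wsum_next.
  rewrite -integral_indic; last 2 first.
  - exact: bigcap_measurable.
  - by rewrite -[X in measurable X]setTI; exact: measurable_wsum.
  by apply: eq_integral => w _; rewrite /f -wsum_rcons.
rewrite key// muleC; congr (_ * _).
have := key fset0 E; rewrite set_fset0 bigcap_set0 setIT probability_setT mul1e.
by move=> ->.
Qed.

Lemma integral_wsum_rcons x a c f : ge0_meas f ->
  \int[P]_w f (wsum x (rcons a c) w) =
  \int[P]_w shiftop P setT (fun w => c * Y (size a) w)%R f (wsum x a w).
Proof.
move=> hf; under eq_integral do rewrite wsum_rcons.
rewrite integral_indep_sum//; last 2 first.
- exact: measurable_wsum.
- move=> B C mB mC.
  have := @indep_wsum_next x a c fset0 (fun=> set0) (@indep_wsum x a).
  by rewrite set_fset0 bigcap_set0; exact.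
by rewrite probability_setT mul1e.
Qed.

Hypothesis Y_ident : forall k A, measurable A -> P (Y k @^-1` A) = P (Y 0%N @^-1` A).

Lemma scaled_opE c k f : ge0_meas f ->
  shiftop P setT (fun w => c * Y k w)%R f = scaled_op (Y 0%N) c f.
Proof.
move=> hf; apply: eq_shiftop => // A mA; rewrite !setIT.
have mcA : measurable ((fun y => c * y)%R @^-1` A).
  rewrite -[X in measurable X]setTI.
  by apply: (_ : measurable_fun setT (fun y => c * y)%R) => //; exact: measurable_funM.
exact: (Y_ident k mcA).
Qed.

Lemma foldr_scaled_op_sigma_linear a :
  sigma_linear (fun f => foldr (scaled_op (Y 0%N)) f a).
Proof.
elim: a => [|c a IHa]; first by split.
exact: (sigma_linear_comp (scaled_op_sigma_linear (Y 0%N) c) IHa).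
Qed.

(** The last mark is integrated out first, so its operator is innermost, as in [foldr]. *)
Lemma integral_wsum x a f : ge0_meas f ->
  \int[P]_w f (wsum x a w) = foldr (scaled_op (Y 0%N)) f a x.
Proof.
elim/last_ind: a f => [|a c IHa] f hf.
  rewrite /wsum; under eq_integral do rewrite big_ord0 addr0.
  by rewrite integral_cst// [X in _ * X](probability_setT P) mule1.
rewrite integral_wsum_rcons// scaled_opE// foldr_rcons IHa//.
exact: sigma_linear_meas (scaled_op_sigma_linear (Y 0%N) c) _ hf.
Qed.

(** Independence between whole families is assumed for their generated sigma-algebras; this places
    the events on sums there. *)
Lemma sigma_of_family_wsum x a B : measurable B ->
  sigma_of_family [set: nat] Y (wsum x a @^-1` B).
Proof.
move=> mB.
pose G := \bigcup_(i in [set: nat]) g_sigma_algebra_preimage (Y i).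
have mY k : measurable_fun [set: g_sigma_algebraType G]
    (Y k : g_sigma_algebraType G -> R).
  move=> _ C mC; rewrite setTI; apply: sub_sigma_algebra.
  by exists k => //; exists C => //; rewrite setTI.
have : measurable_fun [set: g_sigma_algebraType G]
    (wsum x a : g_sigma_algebraType G -> R).
  apply: measurable_funD => //; apply: measurable_sum => k.
  by apply: measurable_funM => //; exact: mY.
by move=> /(_ measurableT B mB); rewrite setTI.
Qed.

End weighted_sums.

(** * Compound Poisson operators *)

Section affine_change_of_variables.
Context (R : realType) (a b : R).
Hypothesis a0 : 0 < a.
Let aff (x : R) : R := a * x + b.

Lemma measurable_affine : measurable_fun setT aff.
Proof. by apply: measurable_funD => //; exact: measurable_funM. Qed.

(** The right side is a measure in [A] that gives half-open intervals their length, hence it is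
    Lebesgue measure. *)
Lemma lebesgue_measure_affine (A : set R) : measurable A ->
  lebesgue_measure A = (a%:E * lebesgue_measure (aff @^-1` A))%E.
Proof.
move=> mA.
transitivity (pushforward (mscale (NngNum (ltW a0)) (@lebesgue_measure R))
  (aff : _ -> measurableTypeR R) A);
  last by [].
apply: lebesgue_measure_unique => //; first exact: measurable_affine.
move=> maff _ [[x y] _ <-]; rewrite /= /pushforward /mscale/=.
have -> : aff @^-1` `]x, y]%classic = `](x - b) / a, (y - b) / a]%classic.
  apply/seteqP; split => z /=; rewrite !in_itv/= /aff.
    by rewrite ltr_pdivrMr// ler_pdivlMr// ltrBlDr lerBrDr mulrC.
  by rewrite ltr_pdivrMr// ler_pdivlMr// ltrBlDr lerBrDr mulrC.
rewrite !lebesgue_measure_itv/= !lte_fin ltr_pM2r ?invr_gt0// ltrD2r.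
case: ifPn => _; last by rewrite mule0.
by rewrite -!EFinB -EFinM; congr _%:E; field; rewrite gt_eqF.
Qed.

Lemma ge0_integral_affine (D D' : set R) (f : R -> \bar R) :
  measurable D -> measurable_fun setT f -> (forall x, (0 <= f x)%E) ->
  (fun x => a * x + b) @^-1` D = D' ->
  (\int[lebesgue_measure]_(x in D) f x =
   a%:E * \int[lebesgue_measure]_(x in D') f (a * x + b)%R)%E.
Proof.
move=> mD mf f0 <-.
have maff : measurable_fun setT (aff : measurableTypeR R -> measurableTypeR R).
  exact: measurable_affine.
have <- := @ge0_integral_pushforward _ _ (measurableTypeR R) (measurableTypeR R)
  R aff maff (@lebesgue_measure R) D f mD (measurable_funTS mf) (fun y _ => f0 y).
apply/esym; etransitivity.
  apply: esym.
  apply: (@ge0_integral_mscale _ (measurableTypeR R) R _ D mD (NngNum (ltW a0)) f) => //.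
  exact: measurable_funTS.
apply: eq_measure_integral => A mA _; apply/esym.
exact: lebesgue_measure_affine.
Qed.

End affine_change_of_variables.

Section time_mark_measure.
Local Open Scope ereal_scope.
Context (R : realType) d (T : measurableType d) (P : probability T R).

(* An alias, because the canonical sigma-finite structure of a product of
   measures is only found for sub-probabilities. *)
Definition leb_prod : set (measurableTypeR R * T) -> \bar R :=
  lebesgue_measure \x P.

HB.instance Definition _ := Measure.on leb_prod.

Let leb_prod_sigma_finite : sigma_finite setT leb_prod.
Proof.
have [F FT Foo] := sigma_finiteT (@lebesgue_measure R).
exists (fun n => F n `*` setT); first by rewrite -setX_bigcupl -FT setXTT.
move=> n; have [mF Fn] := Foo n; split; first exact: measurableX.
by rewrite /leb_prod product_measure1E// [X in _ * X](probability_setT P) mule1.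
Qed.

HB.instance Definition _ := Measure_isSigmaFinite.Build _ _ _ leb_prod
  leb_prod_sigma_finite.

End time_mark_measure.

(** * Operators of jumps damped with age *)

Section jump_operator.
Local Open Scope ereal_scope.
Context (R : realType) d (T : measurableType d) (P : probability T R).
Variable V : {RV P >-> R}.
Local Notation mu := (@lebesgue_measure R).

(* lambda * jumpop D r is the generator of the compound Poisson sum of the
   jumps r s * V arriving at rate lambda during s \in D. *)
Definition jumpop (D : set R) (r : R -> R) :=
  shiftop (leb_prod P) (D `*` setT) (fun z => r z.1 * V z.2)%R.

Let measurable_jump (r : R -> R) : measurable_fun setT r ->
  measurable_fun setT (fun z : measurableTypeR R * T => r z.1 * V z.2)%R.
Proof. by move=> mr; apply: measurable_funM; exact: measurableT_comp. Qed.

Let measurableDT (D : set R) : measurable D ->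
  measurable (D `*` setT : set (measurableTypeR R * T)).
Proof. by move=> mD; exact: measurableX. Qed.

Lemma jumpop_sigma_linear D r : measurable D -> measurable_fun setT r ->
  sigma_linear (jumpop D r).
Proof.
move=> mD mr; apply: shiftop_sigma_linear; [exact: measurableDT|].
exact: measurable_jump.
Qed.

Lemma measurable_scaled_op (r : R -> R) f x : measurable_fun setT r -> ge0_meas f ->
  measurable_fun setT (fun s => scaled_op V (r s) f x).
Proof.
move=> mr [mf f0].
pose H (z : measurableTypeR R * T) := f (x + r z.1 * V z.2)%R.
apply: (measurable_fun_fubini_tonelli_F (m2 := P) H) => [|z]; last exact: f0.
apply: measurableT_comp => //; apply: measurable_funD => //.
exact: measurable_jump.
Qed.

Lemma jumpopE D r f x : measurable D -> measurable_fun setT r -> ge0_meas f ->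
  jumpop D r f x = \int[mu]_(s in D) scaled_op V (r s) f x.
Proof.
move=> mD mr [mf f0]; rewrite /jumpop /shiftop [LHS]integral_mkcond.
rewrite /leb_prod fubini_tonelli1; last 2 first.
- apply/(measurable_restrictT _ _).1; first exact: measurableDT.
  apply: measurable_funTS; apply: measurableT_comp => //.
  by apply: measurable_funD => //; exact: measurable_jump.
- by move=> z; apply: erestrict_ge0.
rewrite [RHS]integral_mkcond; apply: eq_integral => s _.
rewrite patchE /fubini_F; case: ifPn => sD.
  by apply: eq_integral => w _; rewrite patchE in_setX/= sD in_setT.
by rewrite integral0_eq// => w _; rewrite patchE in_setX/= (negbTE sD).
Qed.

(** Meant for one grid cell, on which the step approximation of the decay is constant. *)
Lemma jumpop_cst D r c f : measurable D -> measurable_fun setT r -> ge0_meas f ->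
  (forall s, D s -> r s = c) -> jumpop D r f = fun x => mu D * scaled_op V c f x.
Proof.
move=> mD mr hf rc; apply/funext => x; rewrite jumpopE//.
rewrite (eq_integral (cst (scaled_op V c f x))); last first.
  by move=> s; rewrite inE => /rc ->.
by rewrite integral_cst// muleC.
Qed.

Lemma jumpop_setU D D' r f : measurable D -> measurable D' ->
  [disjoint D & D'] -> measurable_fun setT r -> ge0_meas f ->
  jumpop (D `|` D') r f = jumpop D r f \+ jumpop D' r f.
Proof.
move=> mD mD' DD' mr hf; rewrite /jumpop.
have -> : (D `|` D') `*` [set: T] = (D `*` setT) `|` (D' `*` setT).
  by apply/seteqP; split=> -[s w] /= => [[[]]|[[]|[]]]; auto.
rewrite shiftop_setU//.
- exact: measurableDT.
- exact: measurableDT.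
- apply/disj_setPS => -[s w] /= [[sD _] [sD' _]].
  by move/disj_setPS : DD' => /(_ s); exact.
- exact: measurable_jump.
Qed.

Lemma jumpop_comm D D' r f : measurable D -> measurable D' ->
  measurable_fun setT r -> ge0_meas f ->
  jumpop D r (jumpop D' r f) = jumpop D' r (jumpop D r f).
Proof.
move=> mD mD' mr hf; apply: shiftop_comm => //;
  by [exact: measurableDT|exact: measurable_jump].
Qed.

Lemma expop_jumpop_setU (c : R) D D' r f : (0 <= c)%R -> measurable D ->
  measurable D' -> [disjoint D & D'] -> measurable_fun setT r -> ge0_meas f ->
  expop c (jumpop (D `|` D') r) f =
  expop c (jumpop D r) (expop c (jumpop D' r) f).
Proof.
move=> c0 mD mD' DD' mr hf; apply: expop_commuting_sum; [| | | |exact: c0|exact: hf].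
- exact: jumpop_sigma_linear.
- exact: jumpop_sigma_linear.
- by move=> g hg; exact: jumpop_comm.
- by move=> g hg; exact: jumpop_setU.
Qed.

(** Since [c * (x + r s * y) = c * x + r (s + h) * y], the substitution of [s + h] for [s] gives the
    identity. *)
Lemma jumpop_translation (a b h : R) (r : R -> R) c f : measurable_fun setT r ->
  ge0_meas f -> (forall s, r (s + h) = c * r s)%R ->
  jumpop `[a, b[ r (fun x => f (c * x)%R) =
  fun x => jumpop `[(a + h)%R, (b + h)%R[ r f (c * x)%R.
Proof.
move=> mr hf rh; apply/funext => x.
have hfc : ge0_meas (fun x => f (c * x)%R).
  split=> [|y]; last exact: hf.2.
  by apply: measurableT_comp; [exact: hf.1|exact: measurable_funM].
rewrite (jumpopE _ (measurable_itv _) mr hfc) (jumpopE _ (measurable_itv _) mr hf).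
rewrite [RHS](@ge0_integral_affine _ 1%R h ltr01 _ `[a, b[%classic)//; last 3 first.
- exact: measurable_scaled_op.
- by move=> s; apply: integral_ge0 => w _; exact: hf.2.
- by apply/seteqP; split => s /=; rewrite !in_itv/= mul1r lerD2r ltrD2r.
rewrite mul1e.
apply: eq_integral => s _; apply: eq_integral => w _.
by rewrite mul1r rh mulrDr mulrA.
Qed.

Lemma iter_jumpop_translation (a b h : R) (r : R -> R) c f k :
  measurable_fun setT r -> ge0_meas f -> (forall s, r (s + h) = c * r s)%R ->
  iter k (jumpop `[a, b[ r) (fun x => f (c * x)%R) =
  fun x => iter k (jumpop `[(a + h)%R, (b + h)%R[ r) f (c * x)%R.
Proof.
move=> mr hf rh; elim: k => //= k ->.
rewrite (jumpop_translation (h := h) _ _ mr)//.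
apply: (sigma_linear_meas (sigma_linear_iter k _)) hf.
exact: jumpop_sigma_linear.
Qed.

Lemma expop_jumpop_translation (l a b h : R) (r : R -> R) c f :
  measurable_fun setT r -> ge0_meas f -> (forall s, r (s + h) = c * r s)%R ->
  expop l (jumpop `[a, b[ r) (fun x => f (c * x)%R) =
  fun x => expop l (jumpop `[(a + h)%R, (b + h)%R[ r) f (c * x)%R.
Proof.
move=> mr hf rh; apply/funext => x; apply: eq_eseriesr => k _.
by rewrite (iter_jumpop_translation (h := h) _ _ _ mr).
Qed.

Lemma leb_prod_itv (t : R) : (0 <= t)%R ->
  leb_prod P (`[0%R, t[ `*` setT) = t%:E.
Proof.
move=> t0; rewrite /leb_prod product_measure1E//=.
rewrite [X in _ * X](probability_setT P) mule1 lebesgue_measure_itv/= lte_fin.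
case: ltP => [_|t0']; first by rewrite sube0.
by congr _%:E; apply/le_anti; rewrite t0.
Qed.

Lemma iter_jumpop_le (t : R) r f k x : (0 <= t)%R -> measurable_fun setT r ->
  ge0_meas f -> (forall y, f y <= 1) ->
  iter k (jumpop `[0%R, t[ r) f x <= (t ^+ k)%:E.
Proof.
move=> t0 mr hf f1; apply: iter_shiftop_le => //.
- exact: measurableDT.
- exact: leb_prod_itv.
- exact: measurable_jump.
Qed.

Lemma expop_jumpop_ccvg (l t : R) (r_ : nat -> R -> R) (r : R -> R) f :
  (0 <= l)%R -> (0 <= t)%R ->
  (forall n, measurable_fun setT (r_ n)) -> measurable_fun setT r ->
  ge0_meas f -> (forall x, f x <= 1) -> ccvg (fun=> f) f ->
  (forall s, (0 <= s < t)%R -> r_ ^~ s @ \oo --> r s) ->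
  ccvg (fun n => expop l (jumpop `[0%R, t[ (r_ n)) f)
       (expop l (jumpop `[0%R, t[ r) f).
Proof.
move=> l0 t0 mr_ mr hf f1 fcvg rcvg.
apply: (expop_shiftop_ccvg (M := t)) => //.
- exact: measurableDT.
- exact: leb_prod_itv.
- by move=> n; exact: measurable_jump.
- exact: measurable_jump.
- move=> [s w] [/=]; rewrite in_itv/= => /rcvg rs _.
  by apply: cvgM => //; exact: cvg_cst.
Qed.

End jump_operator.

Section poisson_operator.
Local Open Scope ereal_scope.
Context (R : realType).

Lemma expopZ (c k : R) A f : (0 <= c)%R -> (0 <= k)%R -> sigma_linear A ->
  ge0_meas f ->
  expop c A (fun x => k%:E * f x) = fun x => k%:E * expop c A f x.
Proof.
move=> c0 k0 lA hf; apply/funext => x; rewrite /expop -nneseriesZl; last first.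
  move=> n _; rewrite mule_ge0 ?lee_fin ?divr_ge0 ?exprn_ge0//.
  exact: (sigma_linear_meas (sigma_linear_iter n lA) hf).2.
apply: eq_eseriesr => n _.
by rewrite (sigma_linearZ (sigma_linear_iter n lA))// muleCA.
Qed.

Definition poisson_op (l : R) (A : (R -> \bar R) -> R -> \bar R) f x :=
  \sum_(k <oo) (poisson_pmf l k)%:E * iter k A f x.

Lemma poisson_op_meas l A f : sigma_linear A -> ge0_meas f ->
  ge0_meas (poisson_op l A f).
Proof.
move=> lA hf; apply: ge0_meas_series => k.
apply: ge0_measZ; first exact: poisson_pmf_ge0.
exact: (sigma_linear_meas (sigma_linear_iter k lA)).
Qed.

(* A Poisson(l * t) number of steps of A is exp(- l t) exp(l B) when B = t A. *)
Lemma poisson_opE (l t : R) A B f : (0 < l)%R -> (0 < t)%R -> sigma_linear A ->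
  ge0_meas f -> (forall g, ge0_meas g -> B g = fun x => t%:E * A g x) ->
  poisson_op (l * t) A f = fun x => (expR (- (l * t)))%:E * expop l B f x.
Proof.
move=> l0 t0 lA hf BA; have l0' := ltW l0; have t0' := ltW t0.
have hiter k : ge0_meas (iter k A f).
  exact: (sigma_linear_meas (sigma_linear_iter k lA)).
have iterB k : iter k B f = fun x => (t ^+ k)%:E * iter k A f x.
  elim: k => [|k IHk]; first by apply/funext => x; rewrite mul1e.
  rewrite iterS IHk BA; last by apply: ge0_measZ => //; exact/exprn_ge0/ltW.
  apply/funext => x; rewrite sigma_linearZ//; last exact/exprn_ge0/ltW.
  by rewrite muleA -EFinM -exprS.
apply/funext => x; rewrite /poisson_op /expop -nneseriesZl; last first.
  move=> k _; rewrite iterB !mule_ge0 ?lee_fin ?divr_ge0 ?exprn_ge0//.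
  exact: (hiter k).2.
apply: eq_eseriesr => k _; rewrite iterB !muleA -!EFinM /poisson_pmf mulr_gt0//.
by congr (_%:E * _); rewrite exprMn; ring.
Qed.

Context d (T : measurableType d) (P : probability T R).
Variable V : {RV P >-> R}.

Lemma foldr_poisson_op_meas l f a : ge0_meas f ->
  ge0_meas (foldr (fun c => poisson_op l (scaled_op V c)) f a).
Proof.
move=> hf; elim: a => //= c a IHa; apply: poisson_op_meas => //.
exact: scaled_op_sigma_linear.
Qed.

Let expop_jumpop_meas l a b r f : (0 <= l)%R -> measurable_fun setT r ->
  ge0_meas f -> ge0_meas (expop l (jumpop V `[a, b[ r) f).
Proof.
by move=> l0 mr hf; apply: expop_meas => //; exact: jumpop_sigma_linear.
Qed.

(** Cell [n] contributes a new outermost operator, hence the reversed list. By [poisson_opE] it is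
    the normalized exponential of the jump operator of that cell, and exponentials over adjacent
    cells multiply. *)
Lemma foldr_poisson_op (l t : R) (c : nat -> R) (r : R -> R) f n :
  (0 < l)%R -> (0 < t)%R -> measurable_fun setT r -> ge0_meas f ->
  (forall i s, (i < n)%N -> (i%:R * t <= s < i.+1%:R * t)%R -> r s = c i) ->
  foldr (fun c => poisson_op (l * t) (scaled_op V c)) f
    [seq c i | i <- rev (iota 0 n)] =
  fun x => (expR (- (l * (n%:R * t))))%:E *
    expop l (jumpop V `[0%R, (n%:R * t)%R[ r) f x.
Proof.
move=> l0 t0 mr hf; have l0' := ltW l0; elim: n => [|n IHn] rc.
  apply/funext => x; rewrite mul0r mulr0 oppr0 expR0 mul1e /expop.
  (* On an empty interval the operator vanishes, and only the term [k = 0] of the exponential series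
     remains. *)
  have J0 g y : jumpop V `[0%R, 0%R[ r g y = 0.
    rewrite /jumpop /shiftop set_itv_ge ?bnd_simp ?ltxx// set0X.
    exact: integral_set0.
  have iter0 k y : 0 <= iter k (jumpop V `[0%R, 0%R[ r) f y.
    by case: k => [|k]; [exact: hf.2|rewrite iterS J0].
  rewrite (nneseries_split _ 1); last first.
    by move=> k _; rewrite mule_ge0 ?lee_fin ?divr_ge0 ?exprn_ge0.
  rewrite big_nat1 fact0 divr1 mul1e eseries0 ?adde0//.
  by move=> [|k]// _ _; rewrite iterS J0 mule0.
rewrite -addn1 iotaD rev_cat/= IHn; last by move=> i s /ltnW; exact: rc.
rewrite add0n addn1.
have nt0 : (0 <= n%:R * t)%R by rewrite mulr_ge0// ltW.
have ntS : (n.+1%:R * t = n%:R * t + t)%R by rewrite -natr1 mulrDl mul1r.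
pose D := `[(n%:R * t)%R, (n.+1%:R * t)%R[%classic : set R.
have muD : lebesgue_measure D = t%:E.
  rewrite /D lebesgue_measure_itv/= lte_fin ntS ltrDl t0.
  by rewrite -EFinB addrAC subrr add0r.
have lc := scaled_op_sigma_linear V (c n).
have hE := expop_jumpop_meas 0%R (n%:R * t)%R (ltW l0) mr hf.
rewrite (@poisson_opE l t _ (jumpop V D r) _ l0 t0 lc); last 2 first.
- by apply: ge0_measZ; [exact: expR_ge0|exact: hE].
- move=> g hg; rewrite (@jumpop_cst _ _ _ _ V D r (c n) g (measurable_itv _) mr hg).
    by rewrite muD.
  by move=> s; rewrite /D /= in_itv/=; exact: rc.
apply/funext => x; rewrite (expopZ l0' (expR_ge0 _) _ hE); last first.
  exact: jumpop_sigma_linear (measurable_itv _) mr.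
rewrite muleA -EFinM -expRD.
rewrite -(expop_jumpop_setU V l0' (measurable_itv _) (measurable_itv _) _ mr hf);
  last first.
  apply/disj_setPS => s [] /=; rewrite !in_itv/= => /andP[ns _] /andP[_].
  by rewrite ltNge ns.
congr (_%:E * expop l (jumpop V _ r) f x).
  by congr expR; rewrite ntS; ring.
rewrite setUC /D; apply/esym.
have := @itv_bndbnd_setU _ _ (BLeft 0%R) (BLeft (n%:R * t)%R) (BLeft (n.+1%:R * t)%R).
by apply; rewrite bnd_simp// ntS lerDl ltW.
Qed.

End poisson_operator.

(** * Sums over random blocks *)

Section randomly_many_terms.
Local Open Scope ereal_scope.
Context (R : realType) d (T : measurableType d) (P : probability T R).
Variable Y : nat -> {RV P >-> R}.

(* The weights of the successive terms of Y when step i brings nth 0 v i of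
   them, each with weight c i. *)
Definition block_weights (c : nat -> R) (v : seq nat) : seq R :=
  flatten [seq nseq (nth 0%N v i) (c i) | i <- iota 0 (size v)].

Lemma block_weights_rcons c v k :
  block_weights c (rcons v k) = block_weights c v ++ nseq k (c (size v)).
Proof.
rewrite /block_weights size_rcons -addn1 iotaD map_cat flatten_cat/= cats0.
rewrite add0n nth_rcons ltnn eqxx; congr (flatten _ ++ _).
apply/eq_in_map => i; rewrite mem_iota add0n => /andP[_ iv].
by rewrite nth_rcons iv.
Qed.

Lemma foldr_nseq A (op : R -> A -> A) z k c :
  foldr op z (nseq k c) = iter k (op c) z.
Proof. by elim: k => //= k ->. Qed.

Variable V : nat -> T -> nat.

Definition increments_until n w := [seq V i w | i <- iota 0 n].

Definition increments_are (v : seq nat) : set T :=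
  [set w | increments_until (size v) w = v].

(** The form of the event to which the independence of the increments applies. *)
Lemma increments_areE v : increments_are v =
  \bigcap_(i in [set` [fset i in iota 0 (size v)]%fset]) V i @^-1` [set (nth 0%N v i)].
Proof.
apply/seteqP; split => w /=.
  move=> wv i; rewrite /= !inE mem_iota add0n => /andP[_ iv].
  by rewrite -[in RHS]wv (nth_map 0%N) ?size_iota// nth_iota.
move=> wv; apply: (@eq_from_nth _ 0%N); first by rewrite size_map size_iota.
move=> i; rewrite size_map size_iota => iv.
rewrite (nth_map 0%N) ?size_iota// nth_iota// add0n.
by apply: wv; rewrite /= !inE mem_iota.
Qed.

Lemma increments_are_bigcup v :
  increments_are v = \bigcup_k increments_are (rcons v k).
Proof.
rewrite /increments_are /increments_until; apply/seteqP; split => w /=.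
  move=> wv; exists (V (size v) w) => //=.
  by rewrite size_rcons -addn1 iotaD map_cat add0n wv cats1.
move=> [k _ /=]; rewrite size_rcons -addn1 iotaD map_cat cats1.
by move=> /rcons_inj[].
Qed.

Lemma increments_are_disjoint v :
  trivIset setT (fun k => increments_are (rcons v k)).
Proof.
apply/trivIsetP => i j _ _ ij; apply/disj_set2P/disj_setPS => w [].
rewrite /increments_are /= !size_rcons => -> /rcons_inj[/eqP].
by rewrite (negbTE ij).
Qed.

Variable l : R.
Hypothesis mV : forall i k, measurable (V i @^-1` [set k]).
Hypothesis V_poisson : forall i, has_poisson_law P l (V i).
Hypothesis V_indep : independent_RVs P V.

Lemma measurable_increments_are v : measurable (increments_are v).
Proof.
rewrite increments_areE; apply: fin_bigcap_measurable => [|i _]; last exact: mV.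
exact: finite_fset.
Qed.

Lemma probability_increments_are v :
  P (increments_are v) = (\prod_(i <- iota 0 (size v)) poisson_pmf l (nth 0%N v i))%R%:E.
Proof.
rewrite increments_areE V_indep; last first.
  by move=> i _; exists [set (nth 0%N v i)] => //; rewrite setTI.
rewrite -prodEFin (perm_big (iota 0 (size v))).
  by apply: eq_bigr => i _; rewrite V_poisson.
apply: uniq_perm; [exact: fset_uniq|exact: iota_uniq|].
by move=> i; rewrite !inE.
Qed.

Hypothesis Y_indep : independent_RVs P Y.
Hypothesis Y_ident :
  forall k A, measurable A -> P (Y k @^-1` A) = P (Y 0%N @^-1` A).
Hypothesis VY_indep : forall v x a B, measurable B ->
  P (wsum Y x a @^-1` B `&` increments_are v) =
  P (wsum Y x a @^-1` B) * P (increments_are v).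

Variables (c : nat -> R) (f : R -> \bar R).
Hypothesis hf : ge0_meas f.

Let S x n w := wsum Y x (block_weights c (increments_until n w)) w.

(** The list of increments takes countably many values, and for each of them the weights are
    deterministic. *)
Lemma measurable_random_wsum x n : measurable_fun setT (S x n).
Proof.
move=> _ A mA; rewrite setTI.
have -> : S x n @^-1` A = \bigcup_(v : seq nat) (if size v == n then
    increments_are v `&` wsum Y x (block_weights c v) @^-1` A else set0).
  apply/seteqP; split => [w wA|w [v _]].
    exists (increments_until n w) => //; rewrite size_map size_iota eqxx.
    by split => //; rewrite /increments_are /= size_map size_iota.
  by case: eqP => // <- [wv]; rewrite /= /S wv.
apply: countable_bigcupT_measurable; first exact: countableP.
move=> v; case: ifP => // _; apply: measurableI; first exact: measurable_increments_are.
by rewrite -[X in measurable X]setTI; exact: measurable_wsum.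
Qed.

Let opf (c : R) := poisson_op l (scaled_op (Y 0%N) c).

Let opf_meas a : ge0_meas (foldr opf f a).
Proof. exact: foldr_poisson_op_meas. Qed.

(** Induction on the number [j] of increments still free. The prescribed blocks [v] act through one
    operator per mark, the free ones through Poisson operators; [v] empty is the case wanted. *)
Let integral_random_wsum_on x n j v : (size v + j = n)%N ->
  \int[P]_(w in increments_are v) f (S x n w) = P (increments_are v) *
    foldr (scaled_op (Y 0%N)) (foldr opf f [seq c i | i <- iota (size v) j])
      (block_weights c v) x.
Proof.
elim: j v => [|j IHj] v vn.
  rewrite addn0 in vn; rewrite -integral_wsum// -vn.
  (* The added constant 0 brings the claim under [integral_indep_sum]: with all increments
     prescribed, the sum is independent of the event. *)
  transitivity (\int[P]_(w in increments_are v)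
      f (wsum Y x (block_weights c v) w + 0)%R).
    by apply: eq_integral => w; rewrite inE /S addr0 => wv; rewrite wv.
  rewrite (@integral_indep_sum _ _ _ _ (wsum Y x (block_weights c v)) (cst 0%R))//.
  - congr (_ * _); apply: eq_integral => w _; rewrite /shiftop/=.
    by rewrite addr0 integral_cst// [X in _ * X](probability_setT P) mule1.
  - exact: measurable_wsum.
  - exact: measurable_increments_are.
  - move=> B C mB mC; rewrite preimage_cst; case: ifPn => _.
      by rewrite setIT probability_setT mule1 VY_indep.
    by rewrite setI0 set0I measure0 mule0 mul0e.
rewrite increments_are_bigcup ge0_integral_bigcup//; last first.
- exact: increments_are_disjoint.
- by move=> w _; exact: hf.2.
- apply: measurable_funTS; apply: measurableT_comp; first exact: hf.1.
  exact: measurable_random_wsum.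
- by move=> k; exact: measurable_increments_are.
rewrite -increments_are_bigcup probability_increments_are.
set g := foldr opf f [seq c i | i <- iota (size v).+1 j].
have hg k : ge0_meas (iter k (scaled_op (Y 0%N) (c (size v))) g).
  apply: (sigma_linear_meas (sigma_linear_iter k _)); last exact: opf_meas.
  exact: scaled_op_sigma_linear.
have lv := foldr_scaled_op_sigma_linear Y (block_weights c v).
(* The Poisson sum over the size [k] of the next block is moved outside the operators of the fixed
   blocks, to match the events [rcons v k] term by term. *)
rewrite /= -/g /opf /poisson_op (sigma_linear_series lv); last first.
  by move=> k; apply: ge0_measZ; [exact: poisson_pmf_ge0|exact: hg].
rewrite -nneseriesZl; last first.
  move=> k _; rewrite (sigma_linearZ lv) ?poisson_pmf_ge0//.
  rewrite mule_ge0 ?lee_fin ?poisson_pmf_ge0//.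
  exact: (sigma_linear_meas lv (hg k)).2.
apply: eq_eseriesr => k _.
rewrite (sigma_linearZ lv) ?poisson_pmf_ge0//.
rewrite IHj ?size_rcons ?addSnnS// block_weights_rcons foldr_cat foldr_nseq -/g.
rewrite muleA probability_increments_are size_rcons -addn1 iotaD big_cat/=.
rewrite big_seq1 add0n nth_rcons ltnn eqxx -EFinM; congr (_%:E * _).
congr (_ * _)%R; rewrite big_seq [RHS]big_seq; apply: eq_bigr => i.
by rewrite mem_iota add0n => /andP[_ iv]; rewrite nth_rcons iv.
Qed.

Lemma integral_random_wsum x n :
  \int[P]_w f (wsum Y x (block_weights c (increments_until n w)) w) =
  foldr (fun c => poisson_op l (scaled_op (Y 0%N) c)) f
    [seq c i | i <- iota 0 n] x.
Proof.
have := @integral_random_wsum_on x n n [::] (add0n n).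
have -> : increments_are [::] = setT by apply/seteqP; split.
by move=> ->; rewrite probability_setT mul1e.
Qed.

End randomly_many_terms.

(** * Convergence of the Euler scheme *)

Section euler_scheme.
Context (R : realType).
Local Notation mu := (@lebesgue_measure R).

(** From [1 + z <= expR z] at [z = - x] and at [z = x]; the latter gives
    [expR (- x) <= 1 / (1 + x)], and [(1 - x + x ^+ 2) * (1 + x) = 1 + x ^+ 3]. *)
Lemma expRN_approx (x : R) : 0 <= x -> `|1 - x - expR (- x)| <= x ^+ 2.
Proof.
move=> x0; have e1 := expR_ge1Dx (- x); have e2 := expR_ge1Dx x.
have x1 : 0 < 1 + x by rewrite ltr_wpDr.
have e3 : expR (- x) <= 1 - x + x ^+ 2.
  rewrite expRN (le_trans (_ : _ <= (1 + x)^-1))//.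
    by rewrite lef_pV2// posrE ?expR_gt0.
  rewrite -[leLHS]mul1r ler_pdivrMr//; nra.
rewrite ler_norml; apply/andP; split; lra.
Qed.

Lemma Rintegral_near_cst (f : R -> R) (a b c e : R) : a <= b ->
  mu.-integrable `]a, b] (EFin \o f) ->
  (forall s, a < s <= b -> `|f s - c| <= e) ->
  `|\int[mu]_(s in `]a, b]) f s - c * (b - a)| <= e * (b - a).
Proof.
move=> ab fi fc.
have muab : fine (mu `]a, b]%classic) = b - a.
  rewrite lebesgue_measure_itv/= lte_fin.
  case: ltP => // ba; have -> : a = b by apply/le_anti; rewrite ab ba.
  by rewrite subrr.
have ci k : mu.-integrable `]a, b] (EFin \o cst k).
  apply/integrableP; split; first exact/measurable_EFinP.
  rewrite (eq_integral (cst `|k|%:E))// integral_cst//=.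
  by rewrite lebesgue_measure_itv/= lte_fin; case: ifP => _; rewrite ?mule0 ltry.
have -> : c * (b - a) = \int[mu]_(s in `]a, b]) c by rewrite Rintegral_cst// muab.
rewrite -RintegralB//; last exact: ci.
have fci : mu.-integrable `]a, b] (EFin \o (fun s => f s - c)).
  have mab : measurable (`]a, b]%classic : set (measurableTypeR R)).
    exact: measurable_itv.
  exact: (integrableB mab fi (ci c)).
apply: (le_trans (le_normr_Rintegral _ fci)) => //.
have -> : e * (b - a) = \int[mu]_(s in `]a, b]) e by rewrite Rintegral_cst// muab.
apply: le_Rintegral => //.
- exact: integrable_norm fci.
- exact: ci.
Qed.


Context (X : R -> R) (N : R -> nat) (y : nat -> R) (theta x0 t : R).
Hypotheses (theta0 : 0 < theta) (t0 : 0 < t).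
Hypothesis N0 : N 0 = 0%N.
Hypothesis N_mono : forall s u, 0 <= s -> s <= u -> (N s <= N u)%N.

Let Z s := \sum_(k < N s) y k.
Let I s := \int[mu]_(u in `[0, s]) X u.
(** Total variation of the driving path, which bounds its oscillation within a step. *)
Let B s := \sum_(k < N s) `|y k|.

Hypothesis X_int : forall s, 0 <= s -> mu.-integrable `[0, s] (EFin \o X).
Hypothesis X_eq : forall s, 0 <= s -> X s = x0 - theta * I s + Z s.

Let sumB (u : nat -> R) s s' : 0 <= s -> s <= s' ->
  \sum_(k < N s') u k - \sum_(k < N s) u k = \sum_(N s <= k < N s') u k.
Proof.
move=> s0 ss'; rewrite -!(big_mkord xpredT) (big_cat_nat (n := N s))//=; last first.
  exact: N_mono.
by rewrite addrAC subrr add0r.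
Qed.

Let Z_incr s s' : 0 <= s -> s <= s' -> `|Z s' - Z s| <= B s' - B s.
Proof.
move=> s_ge0 ss'; rewrite /Z /B (sumB y)// (sumB (fun k => `|y k|))//.
exact: ler_norm_sum.
Qed.

Let B_mono s s' : 0 <= s -> s <= s' -> B s <= B s'.
Proof.
by move=> s_ge0 ss'; rewrite -subr_ge0 (le_trans _ (Z_incr s_ge0 ss')).
Qed.

Let I_incr s s' : 0 <= s -> s <= s' ->
  I s' - I s = \int[mu]_(u in `]s, s']) X u.
Proof.
move=> s_ge0 ss'; rewrite /I Rintegral_itvB// ?bnd_simp//.
by apply: X_int; exact: le_trans ss'.
Qed.

Let X_int_oc s s' : 0 <= s -> mu.-integrable `]s, s'] (EFin \o X).
Proof.
move=> s_ge0; have [ss'|s's] := leP s s'.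
  apply: (integrableS _ _ _ (X_int (le_trans s_ge0 ss'))) => //.
  by apply: subset_itvr; rewrite bnd_simp.
rewrite set_itv_ge; last by rewrite bnd_simp -leNgt ltW.
exact: integrable_set0.
Qed.

(** The equation itself bounds the path, through the integral of its absolute value, which is finite
    by the meaning of a solution. *)
Let X_bounded : exists2 K, 0 <= K & forall s, 0 <= s -> s <= t -> `|X s| <= K.
Proof.
have Xt := X_int (ltW t0).
have J0 : 0 <= \int[mu]_(u in `[0, t]) `|X u| by exact: Rintegral_ge0.
have B0 : 0 <= B t by exact: sumr_ge0.
exists (`|x0| + theta * \int[mu]_(u in `[0, t]) `|X u| + B t).
  by rewrite !addr_ge0// mulr_ge0// ltW.
move=> s s_ge0 st; rewrite X_eq// (le_trans (ler_normD _ _))// lerD//; last first.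
  rewrite (le_trans (ler_norm_sum _ _ _))// -/(B s); exact: B_mono.
rewrite (le_trans (ler_normB _ _))// lerD2l normrM (gtr0_norm theta0).
rewrite ler_pM2l//.
have Xs := X_int s_ge0.
rewrite (le_trans (le_normr_Rintegral _ Xs))//.
have -> : \int[mu]_(u in `[0, t]) `|X u| =
    \int[mu]_(u in `[0, s]) `|X u| + \int[mu]_(u in `]s, t]) `|X u|.
  rewrite -(Rintegral_itvB (a := BLeft 0) (b := BRight t) (x := s))//.
  - by rewrite addrC subrK.
  - exact: integrable_norm Xt.
by rewrite lerDl; exact: Rintegral_ge0.
Qed.

(** Over one step [X] moves by at most [theta * K * e] plus the variation of [Z]. Freezing [X] in
    the integral thus costs [(theta * e) ^+ 2 * K] and the term in [B]; replacing [1 - theta * e] by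
    the exponential costs the second [(theta * e) ^+ 2 * K]. *)
Let euler_step K s e : (forall u, 0 <= u -> u <= t -> `|X u| <= K) ->
  0 <= s -> 0 <= e -> s + e <= t ->
  `|X (s + e) - (expR (- (theta * e)) * X s + (Z (s + e) - Z s))| <=
  2 * (theta * e) ^+ 2 * K + theta * e * (B (s + e) - B s).
Proof.
move=> XK s_ge0 e0 set; have K0 : 0 <= K.
  by rewrite (le_trans _ (XK 0 _ _))// ltW.
have st : s <= t by rewrite (le_trans _ set)// lerDl.
have s'E : s + e - s = e by rewrite addrAC subrr add0r.
have dI u : s < u <= s + e -> `|I u - I s| <= K * e.
  move=> /andP[su use].
  rewrite (I_incr s_ge0 (ltW su)).
  have := @Rintegral_near_cst X s u 0 K (ltW su) (X_int_oc _ s_ge0).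
  rewrite mul0r subr0 => dIu; apply: (le_trans (dIu _)).
    move=> v /andP[sv vu]; rewrite subr0 XK//.
      by rewrite (le_trans s_ge0)// ltW.
    by rewrite (le_trans vu)// (le_trans use).
  by rewrite ler_wpM2l// lerBlDr addrC.
have dX u : s < u <= s + e -> `|X u - X s| <= theta * (K * e) + (B (s + e) - B s).
  move=> use; have /andP[su us] := use.
  have u0 : 0 <= u by rewrite (le_trans s_ge0)// ltW.
  rewrite !X_eq//.
  have -> : x0 - theta * I u + Z u - (x0 - theta * I s + Z s) =
      - (theta * (I u - I s)) + (Z u - Z s) by ring.
  rewrite (le_trans (ler_normD _ _))// lerD//.
    by rewrite normrN normrM gtr0_norm// ler_pM2l// dI.
  rewrite (le_trans (Z_incr s_ge0 (ltW su)))// lerD2r.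
  exact: B_mono.
have se : s <= s + e by rewrite lerDl.
have := Rintegral_near_cst se (X_int_oc _ s_ge0) dX.
rewrite -(I_incr s_ge0 se) s'E => dI'.
have s'0 : 0 <= s + e by rewrite addr_ge0.
have -> : X (s + e) - (expR (- (theta * e)) * X s + (Z (s + e) - Z s)) =
    (1 - theta * e - expR (- (theta * e))) * X s
    - theta * (I (s + e) - I s - X s * e).
  have x0E : x0 = X s + theta * I s - Z s by rewrite (X_eq s_ge0); ring.
  by rewrite (X_eq s'0) {1}x0E; ring.
rewrite (le_trans (ler_normB _ _))//.
have -> : 2 * (theta * e) ^+ 2 * K + theta * e * (B (s + e) - B s) =
    (theta * e) ^+ 2 * K + theta * ((theta * (K * e) + (B (s + e) - B s)) * e).
  by ring.
rewrite lerD//.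
  rewrite normrM ler_pM//; last exact: XK.
  by apply: expRN_approx; rewrite mulr_ge0// ltW.
by rewrite normrM gtr0_norm// ler_pM2l.
Qed.

(** Closed form of the recursion that damps the current value by [expR (- (theta * e))] and then
    adds the increment of [Z]; the increment of step [i] is damped in the [m.-1 - i] later steps. *)
Definition euler e m := expR (- (theta * e)) ^+ m * x0 +
  \sum_(i < m) expR (- (theta * e)) ^+ (m.-1 - i) *
    (\sum_(k < N (i.+1%:R * e)) y k - \sum_(k < N (i%:R * e)) y k).

Let eulerS e m : euler e m.+1 = expR (- (theta * e)) * euler e m +
  (Z (m.+1%:R * e) - Z (m%:R * e)).
Proof.
rewrite /euler big_ord_recr/= subnn expr0 mul1r mulrDr addrA exprS mulrA.
congr (_ + _ + _); rewrite mulr_sumr; apply: eq_bigr => i _.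
rewrite mulrA -exprS; congr (_ ^+ _ * _).
by case: m i => [[]//|m] i; rewrite /= subSn// -ltnS.
Qed.

Let X0 : X 0 = x0.
Proof.
rewrite X_eq// /Z N0 big_ord0 addr0 /I set_itv1.
by rewrite Rintegral_set1 mulr0 subr0.
Qed.

(** The damping factor is at most 1, so local errors add up without amplification, and the
    increments of [B] telescope. *)
Let euler_error K e m : (forall u, 0 <= u -> u <= t -> `|X u| <= K) ->
  0 <= e -> m%:R * e <= t ->
  `|X (m%:R * e) - euler e m| <=
  m%:R * (2 * (theta * e) ^+ 2 * K) + theta * e * B (m%:R * e).
Proof.
move=> XK e0; elim: m => [|m IHm] met.
  rewrite !mul0r X0 /euler big_ord0 expr0 mul1r addr0 subrr normr0 add0r.
  by rewrite !mulr_ge0 ?sumr_ge0// ltW.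
have mS : m.+1%:R * e = m%:R * e + e by rewrite -natr1 mulrDl mul1r.
have me0 : 0 <= m%:R * e by rewrite mulr_ge0.
have me : m%:R * e <= t by rewrite (le_trans _ met)// mS lerDl.
have h := IHm me.
have := euler_step XK me0 e0; rewrite -mS => /(_ met) h'.
rewrite eulerS.
have -> : X (m.+1%:R * e) - (expR (- (theta * e)) * euler e m +
    (Z (m.+1%:R * e) - Z (m%:R * e))) =
  (X (m.+1%:R * e) - (expR (- (theta * e)) * X (m%:R * e) +
    (Z (m.+1%:R * e) - Z (m%:R * e)))) +
  expR (- (theta * e)) * (X (m%:R * e) - euler e m) by ring.
rewrite (le_trans (ler_normD _ _))//.
have h2 : `|expR (- (theta * e)) * (X (m%:R * e) - euler e m)| <=
    `|X (m%:R * e) - euler e m|.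
  rewrite normrM ler_piMl// gtr0_norm ?expR_gt0// -[leRHS]expR0 ler_expR.
  by rewrite oppr_le0 mulr_ge0// ltW.
rewrite (le_trans (lerD h' (le_trans h2 h)))// -natr1 le_eqVlt; apply/orP; left.
by apply/eqP; ring.
Qed.

Lemma euler_cvg : euler (t / n.+1%:R) n.+1 @[n --> \oo] --> X t.
Proof.
have [K K0 XK] := X_bounded.
(* For [m = n.+1] and [e = t / n.+1] the bound of [euler_error] equals [C / n.+1]. *)
pose C := 2 * theta ^+ 2 * K * t ^+ 2 + theta * t * B t.
have C0 : 0 <= C.
  have := ltW theta0; have := ltW t0 => t_ge0 theta_ge0.
  by rewrite addr_ge0// !mulr_ge0 ?exprn_ge0 ?sumr_ge0.
have hC : C * n.+1%:R^-1 @[n --> \oo] --> (0 : R).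
  by rewrite -(mulr0 C); apply: cvgMr; exact: cvg_harmonic.
apply/cvgrPdist_le => e e0.
have /cvgrPdist_le/(_ e e0) := hC; apply: filterS => n.
rewrite sub0r normrN ger0_norm ?mulr_ge0 ?invr_ge0//; apply: le_trans.
have ntE : n.+1%:R * (t / n.+1%:R) = t by rewrite mulrC divfK.
have tn0 : 0 <= t / n.+1%:R by rewrite divr_ge0// ltW.
have := @euler_error K (t / n.+1%:R) n.+1 XK tn0; rewrite ntE => /(_ (lexx t)) h.
rewrite (le_trans h)// le_eqVlt; apply/orP; left; apply/eqP; rewrite /C.
by field; rewrite addrC natr1 pnatr_eq0.
Qed.

End euler_scheme.

(** * The law of the process at a fixed time *)

Section block_sums.
Context (R : realType) d (T : measurableType d) (P : probability T R).
Variable Y : nat -> {RV P >-> R}.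

Lemma wsum_cat_nseq x a c k w :
  wsum Y x (a ++ nseq k c) w =
  wsum Y x a w + c * \sum_(size a <= j < size a + k) Y j w.
Proof.
elim: k => [|k IHk]; first by rewrite cats0 addn0 big_geq// mulr0 addr0.
have -> : a ++ nseq k.+1 c = rcons (a ++ nseq k c) c.
  by rewrite -cats1 -catA cats1 -[k.+1]addn1 nseqD -cats1.
rewrite wsum_rcons IHk size_cat size_nseq -addrA -mulrDr addnS.
by rewrite big_nat_recr//= leq_addr.
Qed.

(** The first [j] blocks use exactly [n_ j] marks, so block [j] meets the marks of indices from
    [n_ j] to just below [n_ j.+1], those arriving during step [j]. *)
Lemma wsum_block_weights x c (n_ : nat -> nat) m w : n_ 0 = 0%N ->
  {homo n_ : i j / (i <= j)%N} ->
  wsum Y x (block_weights c [seq n_ i.+1 - n_ i | i <- iota 0 m])%N w =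
  x + \sum_(i < m) c i * (\sum_(k < n_ i.+1) Y k w - \sum_(k < n_ i) Y k w).
Proof.
move=> n0 n_mono.
have sizeE j : size (block_weights c [seq n_ i.+1 - n_ i | i <- iota 0 j])%N = n_ j.
  elim: j => [|j IHj]; first by rewrite n0.
  rewrite -addn1 iotaD map_cat add0n cats1 block_weights_rcons size_cat size_nseq IHj.
  by rewrite subnKC ?addn1// n_mono.
elim: m => [|m IHm]; first by rewrite big_ord0 addr0 /wsum big_ord0 addr0.
rewrite -addn1 iotaD map_cat add0n cats1 block_weights_rcons wsum_cat_nseq.
rewrite IHm sizeE size_map size_iota subnKC ?n_mono// addn1 big_ord_recr/= addrA.
congr (_ + _ * _).
rewrite -!(big_mkord xpredT (fun k => Y k w)).
rewrite (@big_cat_nat _ _ _ (n_ m) 0%N (n_ m.+1))//= ?n_mono//.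
by rewrite addrAC subrr add0r.
Qed.

End block_sums.

Lemma measurable_increment d (T : measurableType d) (M N : T -> nat) k :
  measurable_fun setT M -> measurable_fun setT N ->
  measurable ((fun w => N w - M w)%N @^-1` [set k]).
Proof.
move=> mM mN.
have -> : (fun w => N w - M w)%N @^-1` [set k] = \bigcup_m
    (M @^-1` [set m] `&` N @^-1` [set j | (j - m)%N = k]).
  by apply/seteqP; split => [w /= wk|w [m _ [/= <-]]//]; exists (M w).
apply: bigcupT_measurable => m; apply: measurableI.
  by rewrite -[X in measurable X]setTI; exact: mM.
by rewrite -[X in measurable X]setTI; exact: mN.
Qed.

Section marginal_law.
Context (R : realType) d (T : measurableType d) (P : probability T R).
Variables (theta lambda x0 : R).
Hypotheses (theta_gt0 : 0 < theta) (lambda_gt0 : 0 < lambda).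
Variables (Y : nat -> {RV P >-> R}) (Np : R -> {RV P >-> nat}).
Variable X : R -> {RV P >-> R}.
Hypothesis Y_indep : independent_RVs P Y.
Hypothesis Y_ident :
  forall k A, measurable A -> P (Y k @^-1` A) = P (Y 0%N @^-1` A).
Hypothesis Np_poisson : poisson_process lambda Np.
Hypothesis Np_Y_indep : independent_systems P (fun b : bool =>
  if b then sigma_of_family [set t : R | 0 <= t] Np
  else sigma_of_family [set: nat] Y).
Hypothesis X_OU : OU_solution theta 1 x0 (fun t => random_sum (Np t) Y) X.

Let V (e : R) i := increment Np (i%:R * e) (i.+1%:R * e).

Let measurable_V e i k : measurable (V e i @^-1` [set k]).
Proof. exact: measurable_increment. Qed.

Let V_indep e : 0 <= e -> independent_RVs P (V e).
Proof.
move=> e0; have [_ _] := Np_poisson.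
move=> /(_ (fun i => i%:R * e)); apply; first by rewrite mul0r.
by move=> i j ij; rewrite ler_wpM2r// ler_nat.
Qed.

Let V_poisson e : 0 < e -> forall i, has_poisson_law P (lambda * e) (V e i).
Proof.
move=> e0 i; have [_ + _] := Np_poisson.
move=> /(_ (i%:R * e) (i.+1%:R * e)).
have -> : i.+1%:R * e - i%:R * e = e by rewrite -natr1; ring.
apply.
  by rewrite mulr_ge0// ltW.
by rewrite ltr_pM2r// ltr_nat.
Qed.

Let sigma_of_family_increments_are e v : 0 <= e ->
  sigma_of_family [set t : R | 0 <= t] Np (increments_are (V e) v).
Proof.
move=> e0.
pose G := \bigcup_(t in [set t : R | 0 <= t]) g_sigma_algebra_preimage (Np t).
have mN t : 0 <= t -> measurable_fun [set: g_sigma_algebraType G]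
    (Np t : g_sigma_algebraType G -> nat).
  move=> t0 _ C mC; rewrite setTI; apply: sub_sigma_algebra.
  by exists t => //; exists C => //; rewrite setTI.
apply: (@measurable_increments_are _ (g_sigma_algebraType G) (V e)).
by move=> i k; apply: measurable_increment; apply: mN; rewrite mulr_ge0.
Qed.

Let VY_indep e : 0 <= e -> forall v x a B, measurable B ->
  P (wsum Y x a @^-1` B `&` increments_are (V e) v) =
  (P (wsum Y x a @^-1` B) * P (increments_are (V e) v))%E.
Proof.
move=> e0 v x a B mB.
pose E (b : bool) := if b then increments_are (V e) v else wsum Y x a @^-1` B.
have := @Np_Y_indep [fset false; true]%fset E _.
rewrite big_fsetU1/= ?inE// big_seq_fset1 => <-.
  rewrite set_fsetU1 set_fset1 bigcap_setU1 bigcap_set1.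
  by rewrite /E.
move=> [] _; first exact: sigma_of_family_increments_are.
exact: sigma_of_family_wsum.
Qed.

Let r (s : R) := expR (- (theta * s)).

(* r evaluated at the left end of the grid cell of width e containing s *)
Let r_step (e s : R) := expR (- (theta * ((Num.truncn (s / e))%:R * e))).

Lemma measurable_decay : measurable_fun setT (fun s => expR (- (theta * s))).
Proof.
by apply: measurableT_comp => //; apply: measurableT_comp.
Qed.

Let measurable_r_step e : 0 < e -> measurable_fun setT (r_step e).
Proof.
move=> e0; apply: (measurableT_comp measurable_decay).
apply: measurable_funM => //.
apply: nondecreasing_measurable => // s u su.
by rewrite ler_nat le_truncn// ler_pM2r ?invr_gt0.
Qed.

Let r_step_cvg (e : nat -> R) s : (forall n, 0 < e n) -> e @ \oo --> 0 ->
  0 <= s -> r_step (e n) s @[n --> \oo] --> r s.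
Proof.
move=> e0 ecvg s0.
apply: continuous_cvg; first exact: continuous_expR.
apply: cvgN; apply: cvgMr.
apply: (@squeeze_cvgr _ _ _ _ (fun n => s - e n) (cst s)).
- apply: nearW => n; have en := e0 n.
  have /andP[h1 h2] := truncn_itv (divr_ge0 s0 (ltW en)).
  apply/andP; split.
    rewrite lerBlDr; have /ltW := h2; rewrite ler_pdivrMr// -natr1 mulrDl mul1r.
    exact.
  by rewrite -ler_pdivlMr.
- by rewrite -[X in _ --> X]subr0; apply: cvgB => //; exact: cvg_cst.
- exact: cvg_cst.
Qed.

(** A jump of step [i], seen from the final time [n * e], has its age in cell [n.-1 - i]; the weight
    is the decay at the left end of that cell. *)
Let decay (e : R) n i : R := expR (- (theta * e)) ^+ (n.-1 - i).

Let integral_discretized e n x f : 0 < e -> ge0_meas f ->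
  (\int[P]_w f (wsum Y x (block_weights (decay e n)
     (increments_until (V e) n w)) w) =
  (expR (- (lambda * (n%:R * e))))%:E *
    expop lambda (jumpop (Y 0%N) `[0%R, (n%:R * e)%R[ (r_step e)) f x)%E.
Proof.
move=> e0 hf; have e0' := ltW e0.
rewrite (integral_random_wsum (measurable_V e)
  (V_poisson e0) (V_indep e0') Y_indep Y_ident (VY_indep e0')) //.
have r_stepE i s : (i < n)%N -> i%:R * e <= s < i.+1%:R * e ->
    r_step e s = expR (- (theta * e)) ^+ i.
  move=> _ /andP[is1 is2]; rewrite /r_step (@truncn_def _ (s / e) i).
    by rewrite -expRM_natl; congr expR; ring.
  by rewrite ler_pdivlMr// ltr_pdivrMr// is1.
have /(congr1 (@^~ x)) /= <- := foldr_poisson_op (Y 0%N) lambda_gt0 e0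
  (measurable_r_step e0) hf r_stepE.
(* Time order is the reverse of age order. *)
congr (foldr _ f _ x); rewrite map_rev.
apply: (@eq_from_nth _ 0); first by rewrite size_rev !size_map.
move=> i; rewrite size_map size_iota => iltn.
rewrite nth_rev ?size_map ?size_iota// !(nth_map 0%N) ?size_iota//; last first.
  by rewrite ltn_subrL (leq_ltn_trans _ iltn).
rewrite !nth_iota ?add0n//; last by rewrite ltn_subrL (leq_ltn_trans _ iltn).
by rewrite subnS -subn1 subnAC subn1.
Qed.

Theorem OU_marginal_law (t : R) f : 0 < t -> ge0_meas f ->
  (forall x, f x <= 1)%E -> ccvg (fun=> f) f ->
  (\int[P]_w f (X t w) = (expR (- (lambda * t)))%:E *
    expop lambda (jumpop (Y 0%N) `[0%R, t[ (fun s => expR (- (theta * s)))) f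
      (expR (- (theta * t)) * x0)%R)%E.
Proof.
move=> t0 hf f1 fcvg.
pose e n : R := t / n.+1%:R.
have e0 n : 0 < e n by rewrite divr_gt0.
have ne n : n.+1%:R * e n = t by rewrite mulrC divfK.
have ecvg : e @ \oo --> (0 : R).
  by rewrite -(mulr0 t); apply: cvgMr; exact: cvg_harmonic.
(* The contribution of [x0] to the scheme is the same for every [n], since the damping factors
   multiply exactly to [expR (- (theta * t))]. The integrals of [f (W n)] then have two limits: a
   pathwise one, by the Euler scheme, and one by continuity of the operators. *)
pose x := expR (- (theta * t)) * x0.
pose W n w := wsum Y x (block_weights (decay (e n) n.+1)
  (increments_until (V (e n)) n.+1 w)) w.
have mW n : measurable_fun setT (W n).
  exact: measurable_random_wsum.
have W_cvg : {ae P, forall w, setT w -> f (W n w) @[n --> \oo] --> f (X t w)}.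
  have [Np_path _ _] := Np_poisson.
  apply: filterS2 Np_path X_OU => w [N0 N_mono _] Xw _; apply: fcvg.
  have -> : W ^~ w = fun n => euler (fun s => Np s w) (fun k => Y k w) theta x0
      (e n) n.+1.
    apply/funext => n; rewrite /W (@wsum_block_weights _ _ _ _ _ _ _
      (fun i => Np (i%:R * e n) w))//.
    - by rewrite /euler -expRM_natl /x -[in LHS](ne n); congr (expR _ * _ + _); ring.
    - by rewrite mul0r.
    - by move=> i j ij; rewrite N_mono ?mulr_ge0 ?ler_wpM2r ?ler_nat// ltW.
  apply: (euler_cvg theta_gt0 t0 N0 N_mono (X := X ^~ w)) => s s0.
    by have [] := Xw s s0.
  by have [_] := Xw s s0; rewrite mul1r.
have f_cvg : (\int[P]_w f (W n w))%E @[n --> \oo] --> (\int[P]_w f (X t w))%E.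
  have mfW n : measurable_fun setT (fun w => f (W n w)).
    by apply: measurableT_comp; [exact: hf.1|exact: mW].
  have mfX : measurable_fun setT (fun w => f (X t w)).
    by apply: measurableT_comp; [exact: hf.1|].
  have i1 : P.-integrable setT (cst 1%E) := finite_measure_integrable_cst P 1 measurableT.
  have dom : {ae P, forall w n, setT w -> (`|f (W n w)| <= cst 1 w)%E}.
    by apply/aeW => w n _; rewrite gee0_abs//; exact: hf.2.
  by have [_ _] := dominated_convergence measurableT mfW mfX W_cvg i1 dom.
have op_cvg : (\int[P]_w f (W n w))%E @[n --> \oo] --> ((expR (- (lambda * t)))%:E *
    expop lambda (jumpop (Y 0%N) `[0%R, t[ (fun s => expR (- (theta * s)))) f x)%E.
  under eq_fun do rewrite /W integral_discretized// ne.
  apply: cvgeZl => //.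
  apply: (@expop_jumpop_ccvg _ _ _ _ (Y 0%N) lambda t (fun n => r_step (e n)) r f
    (ltW lambda_gt0) (ltW t0) _ _ hf f1 fcvg).
  - by move=> n; exact: measurable_r_step.
  - exact: measurable_decay.
  - by move=> s /andP[s0 _]; exact: r_step_cvg.
  - exact: cvg_cst.
exact: (cvg_unique _ f_cvg op_cvg).
Qed.

End marginal_law.

(** * Laws and continuous test functions *)

Section law_from_test_functions.
Local Open Scope ereal_scope.
Context (R : realType) d (T : measurableType d) (P : probability T R).

Lemma eq_in_law_rays (U V : {RV P >-> R}) :
  (forall x, P (U @^-1` `]-oo, x[) = P (V @^-1` `]-oo, x[)) -> eq_in_law U V.
Proof.
move=> UV A mA.
apply: (@measure_unique _ R _ (@RGenInftyO.G R)
  (fun n => `]-oo, n%:R[%classic) _ _ _ _ (distribution P U) (distribution P V)) => //.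
- exact: RGenInftyO.measurableE.
- move=> _ _ [x ->] [y ->]; exists (Num.min x y); apply/seteqP.
  by split => z /=; rewrite !in_itv/= lt_min => /andP.
- by move=> n; exists n%:R.
- apply/seteqP; split => // x _; exists (Num.truncn x).+1 => //=.
  by rewrite in_itv/= truncnS_gt.
- by move=> _ [x ->]; exact: UV.
- by move=> n; rewrite (le_lt_trans (probability_le1 _ _)) ?ltry.
Qed.

Lemma eq_in_law_ccvg (U V : {RV P >-> R}) :
  (forall f, ge0_meas f -> (forall x, f x <= 1) -> ccvg (fun=> f) f ->
    \int[P]_w f (U w) = \int[P]_w f (V w)) -> eq_in_law U V.
Proof.
move=> UV; apply: eq_in_law_rays => x.
(* Twice the positive part of [x - y]: it is continuous, and positive exactly on the ray, so the
   functions [1 - expR (- h y) ^+ n] tend to the indicator of the ray. *)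
pose h (y : R) : R := (`|x - y| + (x - y))%R.
have h_ge0 y : (0 <= h y)%R by rewrite -lerBlDr sub0r -normrN ler_norm.
have mh : measurable_fun setT h.
  have mxy : measurable_fun setT (fun y : R => x - y : R)%R by exact: measurable_funB.
  rewrite /h; apply: measurable_funD => //.
  exact: (measurableT_comp (f := @Num.norm R R)).
pose f n (y : R) := (1 - expR (- h y) ^+ n)%R%:E.
have e1 y : (0 <= expR (- h y) <= 1)%R.
  by rewrite expR_ge0/= -[leRHS]expR0 ler_expR oppr_le0.
have mf n : measurable_fun setT (f n).
  apply/measurable_EFinP; apply: measurable_funB => //.
  apply: measurable_funX; apply: measurableT_comp => //.
  exact: measurableT_comp.
have f01 n y : 0 <= f n y <= 1.
  have /andP[e0 le1] := e1 y.
  by rewrite !lee_fin subr_ge0 exprn_ile1//= lerBlDr lerDl exprn_ge0.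
have f_cvg y : f n y @[n --> \oo] --> (\1_`]-oo, x[ y)%:E.
  apply/cvg_EFin; first exact: nearW.
  rewrite indicE; have [yx|xy] := ltP y x.
    rewrite mem_set/= ?in_itv//= -[X in _ --> X]subr0.
    apply: cvgB; first exact: cvg_cst.
    apply: cvg_expr; rewrite ger0_norm ?expR_ge0// -[ltRHS]expR0 ltr_expR oppr_lt0.
    by rewrite /h gtr0_norm ?subr_gt0// addr_gt0 ?subr_gt0.
  rewrite memNset/= ?in_itv/= ?ltNge ?xy//.
  under eq_fun do rewrite /f/= /h ler0_norm ?subr_le0// addNr oppr0 expR0 expr1n subrr.
  exact: cvg_cst.
have lim (W : {RV P >-> R}) :
    \int[P]_w f n (W w) @[n --> \oo] --> P (W @^-1` `]-oo, x[).
  have -> : P (W @^-1` `]-oo, x[) = \int[P]_w (\1_`]-oo, x[ (W w))%:E.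
    have mWx : measurable (W @^-1` `]-oo, x[) by exact: measurable_funPTI.
    by have := integral_indic P measurableT mWx; rewrite setIT => <-.
  apply: (@dominated_cvg _ _ _ P _ measurableT _ _ (cst 1)) => //.
  - by move=> n; apply: measurableT_comp; [exact: mf|].
  - exact: (finite_measure_integrable_cst P 1%R measurableT).
  - by move=> n w _; have /andP[f0 f1] := f01 n (W w); rewrite gee0_abs.
apply: (cvg_unique _ (lim U)) => //.
rewrite (_ : (fun n => _) = (fun n => \int[P]_w f n (V w))); first exact: lim.
apply/funext => n; apply: UV.
- by split=> [|y]; [exact: mf|have /andP[] := f01 n y].
- by move=> y; have /andP[] := f01 n y.
- move=> y_ y y_cvg; apply/cvg_EFin; first exact: nearW.
  apply: cvgB; first exact: cvg_cst.
  under eq_fun do rewrite -expRM_natl; rewrite -expRM_natl.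
  apply: continuous_cvg; first exact: continuous_expR.
  have xy_cvg : (x - y_ k)%R @[k --> \oo] --> (x - y)%R.
    by apply: cvgB => //; exact: cvg_cst.
  by apply: cvgMr; apply: cvgN; apply: cvgD => //; exact: cvg_norm.
Qed.

End law_from_test_functions.

(** * The mixture of double exponentials *)

Section mixture.
Local Open Scope ereal_scope.
Context (R : realType) d (T : measurableType d) (P : probability T R).
Variables (p q eta phi c : R).
Hypotheses (eta_gt0 : (0 < eta)%R) (phi_gt0 : (0 < phi)%R).
Hypotheses (p_gt0 : (0 < p)%R) (q_gt0 : (0 < q)%R) (c_ge0 : (0 <= c)%R).
Variables V W : {RV P >-> R}.
Hypothesis V_density : has_density V (double_exp_pdf p q eta phi).
Hypothesis W_density : has_density W (mixed_double_exp_pdf p q eta phi c).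
Local Notation mu := (@lebesgue_measure R).

Lemma double_exp_pdf_ge0 a b x : (0 <= a)%R -> (0 <= b)%R ->
  (0 <= double_exp_pdf p q a b x)%R.
Proof.
move=> a0 b0; rewrite /double_exp_pdf; case: ifP => _.
  by rewrite !mulr_ge0 ?expR_ge0 ?(ltW p_gt0).
by rewrite !mulr_ge0 ?expR_ge0 ?(ltW q_gt0).
Qed.

Lemma double_exp_pdf_le a b x : (0 <= a)%R -> (0 <= b)%R ->
  (double_exp_pdf p q a b x <= p * a + q * b)%R.
Proof.
move=> a0 b0; have pa : (0 <= p * a)%R by rewrite mulr_ge0// ltW.
have qb : (0 <= q * b)%R by rewrite mulr_ge0// ltW.
rewrite /double_exp_pdf; case: ifPn => [x0|]; last rewrite -ltNge => x0.
  rewrite ler_wpDr// ler_piMr// -[leRHS]expR0 ler_expR.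
  by rewrite mulNr oppr_le0 mulr_ge0.
rewrite ler_wpDl// ler_piMr// -[leRHS]expR0 ler_expR.
by rewrite mulr_ge0_le0// ltW.
Qed.

Let F (z : measurableTypeR R * measurableTypeR R) : R :=
  double_exp_pdf p q (eta * expR (c * z.1)) (phi * expR (c * z.1)) z.2.

Let measurable_F : measurable_fun setT F.
Proof.
have m1 : measurable_fun setT
    (fun z : measurableTypeR R * measurableTypeR R => expR (c * z.1)%R).
  apply: measurableT_comp => //.
  by apply: measurable_funM => //; exact: measurable_fst.
have m2 : measurable_fun setT
    (fun z : measurableTypeR R * measurableTypeR R => z.2 : R) by exact: measurable_snd.
apply: measurable_fun_ifT.
- exact: measurable_fun_ler.
- apply: measurable_funM.
    by apply: measurable_funM => //; exact: measurable_funM.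
  apply: measurableT_comp => //; apply: measurable_funM => //.
  by apply: measurableT_comp => //; exact: measurable_funM.
- apply: measurable_funM.
    by apply: measurable_funM => //; exact: measurable_funM.
  by apply: measurableT_comp => //; apply: measurable_funM => //; exact: measurable_funM.
Qed.

Let F_ge0 z : (0 <= F z)%R.
Proof. by apply: double_exp_pdf_ge0; rewrite mulr_ge0 ?expR_ge0 ?ltW. Qed.

Lemma measurable_double_exp_pdf a b :
  measurable_fun setT (double_exp_pdf p q a b).
Proof.
apply: measurable_fun_ifT.
- exact: measurable_fun_ler.
- by apply: measurable_funM => //; apply: measurableT_comp => //; exact: measurable_funM.
- by apply: measurable_funM => //; apply: measurableT_comp => //; exact: measurable_funM.
Qed.

(** Change of variable [y / a]: at that point the density with rates multiplied by [a] is [a] times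
    the original density at [y]. *)
Lemma scaled_double_exp_law (a : R) A : (0 < a)%R -> measurable A ->
  P ((fun w => a^-1 * V w)%R @^-1` A) =
  \int[mu]_(y in A) (double_exp_pdf p q (eta * a) (phi * a) y)%:E.
Proof.
move=> a0 mA; have a1 : (0 < a^-1)%R by rewrite invr_gt0.
pose A' := (fun z => a^-1 * z + 0)%R @^-1` A.
have mA' : measurable A'.
  rewrite -[X in measurable X]setTI.
  by apply: (_ : measurable_fun setT (fun z => a^-1 * z + 0)%R) => //;
    exact: measurable_affine.
rewrite (@ge0_integral_affine _ _ 0%R a1 A A')//; last 2 first.
- by apply/measurable_EFinP; exact: measurable_double_exp_pdf.
- by move=> y; rewrite lee_fin double_exp_pdf_ge0// mulr_ge0// ltW.
have -> : (fun w => a^-1 * V w)%R @^-1` A = V @^-1` A'.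
  by apply/seteqP; split => w; rewrite /A' /= addr0.
transitivity (distribution P V A'); first by [].
rewrite V_density//.
have E y : double_exp_pdf p q (eta * a) (phi * a) (a^-1 * y + 0) =
    (a * double_exp_pdf p q eta phi y)%R.
  rewrite addr0 /double_exp_pdf pmulr_rge0//; case: ifP => _.
    rewrite (_ : - (eta * a) * (a^-1 * y) = - eta * y)%R; first by ring.
    by field; rewrite gt_eqF.
  rewrite (_ : phi * a * (a^-1 * y) = phi * y)%R; first by ring.
  by field; rewrite gt_eqF.
under [in RHS]eq_integral do rewrite E EFinM.
rewrite ge0_integralZl//.
- by rewrite muleA -EFinM mulVf ?gt_eqF// mul1e.
- by apply: measurable_funTS; apply/measurable_EFinP; exact: measurable_double_exp_pdf.
- by move=> y _; rewrite lee_fin double_exp_pdf_ge0// ltW.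
- by rewrite lee_fin ltW.
Qed.

(** A real-valued integral is the finite part of the extended one, so finiteness has to be proved;
    for [u] in [0, 1] the integrand is at most [(p * eta + q * phi) * expR c]. *)
Let mixed_pdfE y : (mixed_double_exp_pdf p q eta phi c y)%:E =
  \int[mu]_(u in `[0%R, 1%R]) (F (u, y))%:E.
Proof.
rewrite /mixed_double_exp_pdf /Rintegral fineK// ge0_fin_numE; last first.
  by apply: integral_ge0 => u _; rewrite lee_fin; exact: (F_ge0 (u, y)).
have mFy : measurable_fun (`[0%R, 1%R]%classic : set (measurableTypeR R))
    (fun u => (F (u, y))%:E).
  apply: measurable_funTS; apply/measurable_EFinP.
  exact: (measurableT_comp measurable_F (measurable_pair2 y)).
apply: (@le_lt_trans _ _
    (\int[mu]_(u in `[0%R, 1%R]) (cst ((p * eta + q * phi) * expR c)%:E u))).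
  apply: ge0_le_integral => //.
  - by move=> u _; rewrite lee_fin; exact: (F_ge0 (u, y)).
  - move=> u /=; rewrite in_itv/= => /andP[u0 u1]; rewrite lee_fin.
    have e0 (k : R) : (0 < k -> 0 <= k * expR (c * u))%R.
      by move=> k0; rewrite mulr_ge0 ?expR_ge0// ltW.
    rewrite (le_trans (double_exp_pdf_le _ (e0 _ eta_gt0) (e0 _ phi_gt0)))//.
    rewrite !mulrA -mulrDl ler_wpM2l ?ler_expR ?ler_piMr//.
    by rewrite addr_ge0// mulr_ge0// ltW.
rewrite integral_cst//= lebesgue_measure_itv/= lte_fin ltr01.
by rewrite -EFinB -EFinM ltry.
Qed.

(** By Tonelli, [W] is a mixture over [u] of laws with rates multiplied by [expR (c * u)], that is,
    of the laws of [expR (- (c * u)) * V]. *)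
Lemma mixture_law A : measurable A -> P (W @^-1` A) =
  \int[mu]_(u in `[0%R, 1%R]) P ((fun w => expR (- (c * u)) * V w)%R @^-1` A).
Proof.
move=> mA; transitivity (distribution P W A); first by [].
rewrite W_density//; under eq_integral do rewrite mixed_pdfE.
rewrite -(fubini_tonelli_in mu mu _ mA (F := EFin \o F))//.
- by apply: eq_integral => u _; rewrite expRN scaled_double_exp_law// expR_gt0.
- exact/measurable_EFinP.
Qed.

Lemma mixture_shiftop f : ge0_meas f ->
  shiftop P setT W f = jumpop V `[0%R, 1%R] (fun u => expR (- (c * u))) f.
Proof.
move=> hf.
have mr : measurable_fun setT (fun u => expR (- (c * u)) : R)%R.
  exact: measurable_decay.
have mD : measurable (`[0%R, 1%R]%classic : set R) by exact: measurable_itv.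
have mDT : measurable (`[0%R, 1%R] `*` setT : set (measurableTypeR R * T)).
  exact: measurableX.
have mg : measurable_fun setT
    (fun z : measurableTypeR R * T => expR (- (c * z.1)) * V z.2)%R.
  apply: measurable_funM; last exact: measurableT_comp.
  exact: (measurableT_comp mr measurable_fst).
apply: eq_shiftop => // A mA.
(* [jumpopE] for this indicator, at the point 0, turns the product measure of the preimage of [A]
   into the iterated integral of [mixture_law]. *)
pose g y : \bar R := (\1_A y)%:E.
have hg : ge0_meas g by split=> [|y]; [exact/measurable_EFinP|rewrite lee_fin].
have := @jumpopE _ _ _ P V _ _ g 0%R mD mr hg.
move=> jE; transitivity (P (W @^-1` A)); first by rewrite setIT.
rewrite mixture_law//.
transitivity (jumpop V `[0%R, 1%R] (fun u => expR (- (c * u)))%R g 0%R).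
  rewrite jE; apply: eq_integral => u _; rewrite /scaled_op /shiftop.
  have mB : measurable ((fun w => expR (- (c * u)) * V w)%R @^-1` A).
    rewrite -[X in measurable X]setTI.
    by apply: (_ : measurable_fun setT (fun w => expR (- (c * u)) * V w)%R) => //;
      exact: measurable_funM.
  have := integral_indic P measurableT mB; rewrite setIT => <-.
  by apply: eq_integral => w _; rewrite /g add0r.
rewrite /jumpop /shiftop.
have mB : measurable
    ((fun z : measurableTypeR R * T => expR (- (c * z.1)) * V z.2)%R @^-1` A).
  by rewrite -[X in measurable X]setTI; exact: mg.
rewrite -(integral_indic (leb_prod P) mDT mB).
by apply: eq_integral => z _; rewrite /g add0r.
Qed.

(** Substitution [s = h * u]; the endpoint 1 is negligible. This is where the uniform mixing
    variable becomes the age of a jump. *)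
Lemma jumpop_rescale (theta h : R) f : (0 < h)%R -> ge0_meas f ->
  jumpop V `[0%R, h[ (fun s => expR (- (theta * s))) f =
  fun x => h%:E * jumpop V `[0%R, 1%R] (fun u => expR (- (theta * h * u))) f x.
Proof.
move=> h0 hf; apply/funext => x.
rewrite (jumpopE V _ (measurable_itv _) (measurable_decay theta) hf).
rewrite (jumpopE V _ (measurable_itv _) (measurable_decay (theta * h)) hf).
have mphi := measurable_scaled_op V x (measurable_decay theta) hf.
have phi0 s : 0 <= scaled_op V (expR (- (theta * s)))%R f x.
  by apply: integral_ge0 => w _; exact: hf.2.
have preim : (fun s => h * s + 0)%R @^-1` `[0%R, h[ = `[0%R, 1%R[%classic :> set R.
  by apply/seteqP; split => s /=; rewrite !in_itv/= addr0 pmulr_rge0// gtr_pMr.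
rewrite [LHS](@ge0_integral_affine _ h 0%R h0 _ _ _ (measurable_itv _) mphi phi0 preim).
apply: (congr1 (mule h%:E)); rewrite -[RHS]integral_itv_bndo_bndc; last first.
  exact: measurable_funTS (measurable_scaled_op V _ (measurable_decay _) hf).
by apply: eq_integral => s _; rewrite addr0 mulrA.
Qed.

End mixture.

(** * Compound Poisson sums and the theorem *)

Section random_sums.
Local Open Scope ereal_scope.
Context (R : realType) d (T : measurableType d) (P : probability T R).
Variables (S : nat -> {RV P >-> R}) (U : T -> R) (N : {RV P >-> nat}) (l : R).
Hypothesis S_indep : independent_RVs P S.
Hypothesis S_ident :
  forall k A, measurable A -> P (S k @^-1` A) = P (S 0%N @^-1` A).
Hypothesis mU : measurable_fun setT U.
Hypothesis N_poisson : has_poisson_law P l N.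
Hypothesis UNS_indep : forall a B C k, measurable B -> measurable C ->
  P (U @^-1` B `&` wsum S 0 a @^-1` C `&` N @^-1` [set k]) =
  P (U @^-1` B) * P (wsum S 0 a @^-1` C) * P (N @^-1` [set k]).

Lemma integral_compound_poisson f : ge0_meas f ->
  \int[P]_w f (U w + random_sum N S w)%R =
  \int[P]_w poisson_op l (shiftop P setT (S 0%N)) f (U w).
Proof.
move=> hf; set A := shiftop P setT (S 0%N).
have lA : sigma_linear A by apply: shiftop_sigma_linear.
have opA : scaled_op (S 0%N) 1%R = A.
  by apply/funext => g; rewrite /scaled_op; under eq_fun do rewrite mul1r.
have hA k : ge0_meas (iter k A f).
  exact: (sigma_linear_meas (sigma_linear_iter k lA)).
have mUA k : measurable_fun setT (fun w => iter k A f (U w)).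
  by apply: measurableT_comp mU; exact: (hA k).1.
have mN k : measurable (N @^-1` [set k]) by exact: measurable_funPTI.
have -> : setT = \bigcup_k N @^-1` [set k].
  by apply/seteqP; split => // w _; exists (N w).
rewrite ge0_integral_bigcup//; last first.
- by apply/trivIsetP => i j _ _ /eqP ij; apply/seteqP; split => w //= [-> /ij].
- by move=> w _; exact: hf.2.
- apply: measurable_funTS; apply: measurableT_comp; first exact: hf.1.
  by apply: measurable_funD => //; exact: measurable_random_sum.
have -> : \bigcup_k N @^-1` [set k] = setT.
  by apply/seteqP; split => // w _; exists (N w).
rewrite [RHS]integral_nneseries//; last 2 first.
- by move=> k; exact: measurable_funeM.
- by move=> k w _; rewrite mule_ge0 ?lee_fin ?poisson_pmf_ge0//; exact: (hA k).2.
apply: eq_eseriesr => k _.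
rewrite ge0_integralZl ?lee_fin ?poisson_pmf_ge0//; last first.
  by move=> w _; exact: (hA k).2.
(* On [N = k] the sum has [k] unit weights, and [foldr] over them is the [k]-th iterate. *)
have sumE w : N w = k -> random_sum N S w = wsum S 0 (nseq k 1%R) w.
  move=> Nk; rewrite /random_sum /wsum Nk size_nseq add0r.
  by apply: eq_bigr => i _; rewrite nth_nseq ltn_ord mul1r.
rewrite (eq_integral (fun w => f (U w + wsum S 0 (nseq k 1%R) w)%R)); last first.
  by move=> w; rewrite inE /= => /sumE ->.
rewrite integral_indep_sum//; last 2 first.
- exact: measurable_wsum.
- by move=> B C mB mC; exact: UNS_indep.
rewrite N_poisson; congr (_ * _); apply: eq_integral => w _.
have := integral_wsum S_indep S_ident (U w) (nseq k 1%R) hf.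
rewrite foldr_nseq opA => <-; apply: eq_integral => w' _.
by rewrite /wsum add0r.
Qed.

End random_sums.

(** With the factor [expR (- (l * h))] the image of [f] stays at most 1, as required of a test
    function in [OU_marginal_law]. *)
Lemma expop_jumpop_le (R : realType) d (T : measurableType d)
    (P : probability T R) (V : {RV P >-> R}) (l h : R) r f x :
  0 <= l -> 0 <= h -> measurable_fun setT r -> ge0_meas f ->
  (forall y, f y <= 1)%E ->
  (expop l (jumpop V `[0%R, h[ r) f x <= (expR (l * h))%:E)%E.
Proof.
move=> l0 h0 mr hf f1; rewrite -nneseries_exp ?mulr_ge0//.
have coef0 k : 0 <= l ^+ k / k`!%:R by rewrite divr_ge0 ?exprn_ge0.
apply: lee_nneseries => [k _ _|k _].
  rewrite mule_ge0 ?lee_fin ?coef0//.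
  apply: (sigma_linear_meas (sigma_linear_iter k _) hf).2.
  exact: jumpop_sigma_linear (measurable_itv _) mr.
rewrite exprMn mulrAC [leRHS]EFinM lee_wpmul2l ?lee_fin//.
exact: iter_jumpop_le.
Qed.

Theorem corollary5p2 (R : realType) (d : measure_display)
  (T : measurableType d) (P : probability T R)
  (theta lambda eta phi p q x0 : R)
  (theta_gt0 : 0 < theta) (lambda_gt0 : 0 < lambda)
  (eta_gt0 : 0 < eta) (phi_gt0 : 0 < phi)
  (p_gt0 : 0 < p) (q_gt0 : 0 < q) (pq1 : p + q = 1)
  (Y : nat -> {RV P >-> R}) (Np : R -> {RV P >-> nat}) (X : R -> {RV P >-> R})
  (Y_indep : independent_RVs P Y)
  (Y_density : forall k, has_density (Y k) (double_exp_pdf p q eta phi))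
  (Np_poisson : poisson_process lambda Np)
  (Np_Y_indep : independent_systems P (fun b : bool =>
     if b then sigma_of_family [set t : R | 0 <= t] Np
     else sigma_of_family [set: nat] Y))
  (X_OU : OU_solution theta 1 x0 (fun t => random_sum (Np t) Y) X)
  (t h : R) (t_gt0 : 0 < t) (h_gt0 : 0 < h)
  (N : {RV P >-> nat}) (S : nat -> {RV P >-> R})
  (N_poisson : has_poisson_law P (lambda * h) N)
  (S_indep : independent_RVs P S)
  (S_density : forall k,
     has_density (S k) (mixed_double_exp_pdf p q eta phi (theta * h)))
  (XNS_indep : independent_systems P (fun i : 'I_3 => tnth
     [tuple g_sigma_algebra_preimage (X t); g_sigma_algebra_preimage N;
            sigma_of_family [set: nat] S] i)) :
  eq_in_law (X (t + h))
    (expR (- theta * h) *: (X t : {mfun T >-> R}) + random_sum N S).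
Proof.
have Y_ident k A : measurable A -> P (Y k @^-1` A) = P (Y 0%N @^-1` A).
  move=> mA; transitivity (distribution P (Y k) A); first by [].
  by rewrite Y_density//; apply/esym; exact: Y_density.
have S_ident k A : measurable A -> P (S k @^-1` A) = P (S 0%N @^-1` A).
  move=> mA; transitivity (distribution P (S k) A); first by [].
  by rewrite S_density//; apply/esym; exact: S_density.
have lambda_ge0 := ltW lambda_gt0; have h_ge0 := ltW h_gt0.
have marginal s f := @OU_marginal_law _ _ _ _ _ _ _ theta_gt0 lambda_gt0 Y Np X
  Y_indep Y_ident Np_poisson Np_Y_indep X_OU s f.
pose r s := expR (- (theta * s)).
have mr : measurable_fun setT r by exact: measurable_decay.
have rD s u : r (s + u) = r u * r s by rewrite /r mulrDr opprD expRD mulrC.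
pose rho := r h.
pose U w : R := rho * X t w.
have mU : measurable_fun setT U by exact: measurable_funM.
have UNS_indep a B C k : measurable B -> measurable C ->
    P (U @^-1` B `&` wsum S 0 a @^-1` C `&` N @^-1` [set k]) =
    (P (U @^-1` B) * P (wsum S 0 a @^-1` C) * P (N @^-1` [set k]))%E.
  move=> mB mC.
  pose i0 : 'I_3 := inord 0; pose i1 : 'I_3 := inord 1; pose i2 : 'I_3 := inord 2.
  pose E (i : 'I_3) := nth set0
    [:: U @^-1` B; N @^-1` [set k]; wsum S 0 a @^-1` C] i.
  have hE (i : 'I_3) : i \in (i0 |` (i1 |` [fset i2]))%fset -> tnth
      [tuple g_sigma_algebra_preimage (X t); g_sigma_algebra_preimage N;
        sigma_of_family [set: nat] S] i (E i).
    move=> _; rewrite (tnth_nth set0) /E; case: i => [[|[|[|//]]]] i3 /=.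
    - exists ((fun y => rho * y) @^-1` B); last by rewrite setTI.
      rewrite -[X in measurable X]setTI.
      by apply: (_ : measurable_fun setT (fun y => rho * y)) => //;
        exact: measurable_funM.
    - by exists [set k]; rewrite ?setTI.
    - exact: sigma_of_family_wsum.
  have := XNS_indep _ _ hE.
  rewrite !set_fsetU1 set_fset1 !bigcap_setU1 bigcap_set1.
  rewrite !big_fsetU1 ?big_seq_fset1 ?inE -?val_eqE/= ?inordK//.
  rewrite /E !inordK//= => UNS.
  by rewrite -setIA [X in _ `&` X]setIC UNS -muleA [X in (_ * X)%E]muleC.
apply: eq_in_law_ccvg => f hf f1 fcvg.
rewrite marginal//; last by rewrite addr_gt0.
pose J a b := jumpop (Y 0%N) `[a, b[ r.
have lJ a b : sigma_linear (J a b) by exact: jumpop_sigma_linear (measurable_itv _) mr.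
(* By [gE] this is the mean of [f] after adding the compound sum to [x]; the new jumps have ages in
   [0, h[. *)
pose g x := ((expR (- (lambda * h)))%:E * expop lambda (J 0%R h) f x)%E.
have hE : ge0_meas (expop lambda (J 0%R h) f) by exact: expop_meas.
have hg : ge0_meas g by apply: ge0_measZ => //; exact: expR_ge0.
have gE : poisson_op (lambda * h) (shiftop P setT (S 0%N)) f = g.
  apply: (poisson_opE lambda_gt0 h_gt0 _ hf); first exact: shiftop_sigma_linear.
  move=> f' hf'; rewrite /J jumpop_rescale//.
  by rewrite (mixture_shiftop eta_gt0 phi_gt0 p_gt0 q_gt0 _ (Y_density 0%N)
    (S_density 0%N))// mulr_ge0// ltW.
have -> : (\int[P]_w f ((expR (- theta * h) *: (X t : {mfun T >-> R}) +
      random_sum N S)%R w))%E =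
    (\int[P]_w f (U w + random_sum N S w)%R)%E.
  by apply: eq_integral => w _; rewrite /U /rho /r -mulNr.
rewrite (integral_compound_poisson S_indep S_ident mU N_poisson UNS_indep hf) gE.
rewrite (marginal t (fun x => g (rho * x)))//; last 3 first.
- split=> [|x]; last exact: hg.2.
  by apply: measurableT_comp; [exact: hg.1|exact: measurable_funM].
- move=> x; rewrite /g.
  apply: (@le_trans _ _ ((expR (- (lambda * h)))%:E * (expR (lambda * h))%:E)%E).
    by rewrite lee_wpmul2l ?lee_fin ?expR_ge0//; exact: expop_jumpop_le.
  by rewrite -EFinM -expRD addNr expR0.
(* Continuity of [g] is the convergence lemma for a constant sequence of decays. *)
- move=> x_ x x_cvg; apply: cvgeZl => //.
  have r_cvg s : 0 <= s < h -> r s @[n --> \oo] --> r s by move=> _; exact: cvg_cst.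
  have J_cvg := @expop_jumpop_ccvg _ _ _ _ (Y 0%N) lambda h (fun=> r) r f
    lambda_ge0 h_ge0 (fun=> mr) mr hf f1 fcvg r_cvg.
  by apply: (J_cvg (fun n => rho * x_ n)); exact: cvgMr.
(* Scaling by [rho] makes the jumps of [X t] older by [h]; their ages fill [h, t + h[, next to [0,
   h[. *)
rewrite (@expop_jumpop_translation _ _ _ _ (Y 0%N) lambda 0 t h r rho g mr hg); last first.
  by move=> s; rewrite rD.
rewrite add0r -/(J h (t + h)) /g expopZ ?expR_ge0// muleA -EFinM -expRD.
rewrite -(expop_jumpop_setU (Y 0%N) lambda_ge0 (measurable_itv _)
  (measurable_itv _) _ mr hf); last first.
  apply/disj_setPS => s [] /=; rewrite !in_itv/= => /andP[hs _] /andP[_].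
  by rewrite ltNge hs.
have -> : `[h, t + h[ `|` `[0, h[ = `[0, t + h[%classic :> set R.
  rewrite setUC; apply/esym.
  apply: (@itv_bndbnd_setU _ _ (BLeft 0%R) (BLeft h) (BLeft (t + h))).
    by rewrite bnd_simp.
  by rewrite bnd_simp lerDr ltW.
have -> : - (lambda * t) + - (lambda * h) = - (lambda * (t + h)) by ring.
by rewrite mulrA -/(r t) -/(r (t + h)) rD.
Qed.
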